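(* Let $q\in(0,2]$ and let $\beta_c$ be defined by the relation $m\,\psi_q(\beta_c)=1$, with $\psi_q(x)=\frac{e^x-1}{e^x+q-1}$. Let $0<\beta<\beta_c$ and let $\pi_n=\pi_n(\beta)$ be the connection probability between the root and the leaves of $T_n$ for the random cluster model with parameters $(p,q)$, $p=1-e^{-\beta}$, with wired boundary condition. Then $$\lim_{n\to\infty}(\pi_n)^{1/n}=m\,\psi_q(\beta)<1\qquad\text{in }\mathbf P\text{-probability}.$$
   Context: Tree. $\mu$ is a probability distribution on $\{0,1,2,\dots\}$ with $\mu(0)=0$, $\mu(1)<1$; $Z\sim\mu$ and $m:=\mathbf E[Z]<\infty$ (so $m>1$). $T$ is the Galton--Watson tree with offspring law $\mu$ and root $\rho$; $T_n$ is the subtree of vertices at distance at most $n$ from the root, and $\partial T_n$ is the set of vertices at distance exactly $n$. $\mathbf P$ is the law of the tree. Random cluster model. For a finite (multi)graph $G=(V,E)$, $p\in[0,1]$ and $q>0$, $\mathbb P^G_{p,q}(\omega)=\frac1{Z^G_{p,q}}p^{o(\omega)}(1-p)^{f(\omega)}q^{k(\omega)}$ for $\omega\in\{0,1\}^E$, where $o(\omega)$, $f(\omega)$ are the numbers of open ($\omega_e=1$) and closed ($\omega_e=0$) edges, $k(\omega)$ is the number of connected components (on the vertex set $V$) formed by the open edges, and $Z^G_{p,q}$ is the normalizing constant. Wired boundary condition: $\bar T_n$ is the graph obtained from $T_n$ by identifying all vertices of $\partial T_n$ to a single vertex, and $\pi_n(\beta)=\mathbb P^{\bar T_n}_{p,q}(\rho\leftrightarrow\partial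 T_n)$ is the probability that $\rho$ is connected to this vertex by open edges. It is a random variable, function of the tree $T_n$. *)

(* Defs.v *)
From HB Require Import structures.
From mathcomp Require Import all_boot all_order all_algebra.
From mathcomp Require Import all_classical all_reals all_analysis.

Set Implicit Arguments.
Unset Strict Implicit.
Unset Printing Implicit Defensive.

Import Order.TTheory GRing.Theory Num.Theory.
Import numFieldNormedType.Exports.

Local Open Scope classical_set_scope.
Local Open Scope ring_scope.

(* The orientation of an edge given by [ends] is irrelevant: see [open_adj]. *)
Record multigraph := Multigraph {
  vertex : finType;
  edge : finType;
  ends : edge -> vertex * vertex }.

(* All vertices satisfying [B] are identified to the single vertex [None];
   distinct edges stay distinct, so parallel edges may appear. *)
Definition identify (G : multigraph) (B : pred (vertex G)) : multigraph :=
  let proj (v : vertex G) : option {v : vertex G | ~~ B v} := insub v in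
  @Multigraph (option {v : vertex G | ~~ B v}) (edge G)
    (fun e => (proj (ends e).1, proj (ends e).2)).

Section RandomCluster.
Variables (R : realType) (p q : R) (G : multigraph).
Implicit Types w : {ffun edge G -> bool}.

Definition open_adj w : rel (vertex G) := fun x y =>
  [exists e, w e && ((ends e == (x, y)) || (ends e == (y, x)))].

Definition num_open w : nat := #|[pred e | w e]|.
Definition num_closed w : nat := #|[pred e | ~~ w e]|.
Definition num_clusters w : nat := n_comp (open_adj w) predT.

Definition rc_weight w : R :=
  p ^+ num_open w * (1 - p) ^+ num_closed w * q ^+ num_clusters w.

Definition rc_partition : R := \sum_(w : {ffun edge G -> bool}) rc_weight w.

Definition rc_prob (A : pred {ffun edge G -> bool}) : R :=
  \sum_(w : {ffun edge G -> bool} | A w) (rc_weight w / rc_partition).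

Definition rc_connection (x y : vertex G) : R :=
  rc_prob (fun w => connect (open_adj w) x y).

End RandomCluster.

(* Rooted trees in Ulam-Harris coding: a vertex is a finite word of naturals,
   the root is the empty word, and the children of [u] are the words
   [rcons u i] with [i < c u], where [c u] is the number of children of [u]. *)
Section Trees.
Variable c : seq nat -> nat.

Fixpoint generation (n : nat) : seq (seq nat) :=
  if n is k.+1 then
    [seq rcons u i | u <- generation k, i <- iota 0 (c u)]
  else [:: [::]].

Definition tree_vertices (n : nat) : seq (seq nat) :=
  flatten [seq generation k | k <- iota 0 n.+1].

Lemma root_subproof (n : nat) : [::] \in tree_vertices n.
Proof. by rewrite /tree_vertices /= mem_head. Qed.

Definition is_child (u v : seq nat) : bool :=
  prefix u v && (size v == (size u).+1).

Definition tree_graph (n : nat) : multigraph :=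
  @Multigraph (seq_sub (tree_vertices n))
    {e : seq_sub (tree_vertices n) * seq_sub (tree_vertices n)
       | is_child (val e.1) (val e.2)}
    val.

Definition tree_root (n : nat) : vertex (tree_graph n) :=
  SeqSub (root_subproof n).

Definition tree_boundary (n : nat) : pred (vertex (tree_graph n)) :=
  fun v => size (ssval v) == n.

Definition wired_tree (n : nat) : multigraph :=
  identify (@tree_boundary n).

Definition wired_root (n : nat) : vertex (wired_tree n) :=
  insub (tree_root n).

Definition wired_boundary (n : nat) : vertex (wired_tree n) := None.

(* $\pi_n(\beta)$ *)
Definition root_connection (R : realType) (q beta : R) (n : nat) : R :=
  rc_connection (1 - expR (- beta)) q (wired_root n) (wired_boundary n).

End Trees.

Definition psi (R : realType) (q x : R) : R :=
  (expR x - 1) / (expR x + q - 1).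

Section Probability.
Context d (T : measurableType d) (R : realType) (P : probability T R).

Definition mutually_independent (I : choiceType) d' (S : measurableType d')
    (X : I -> {RV P >-> S}) : Prop :=
  forall (s : seq I) (A : I -> set S), uniq s ->
    (forall i, i \in s -> measurable (A i)) ->
    P [set t | forall i, i \in s -> A i (X i t)] =
    (\prod_(i <- s) P (X i @^-1` A i))%E.

(* Offspring variables of a Galton-Watson tree: [xi u] is the number of
   children of [u] (whether or not [u] is actually a vertex of the tree). *)
Definition galton_watson (mu : probability nat R)
    (xi : seq nat -> {RV P >-> nat}) : Prop :=
  (forall u (A : set nat), distribution P (xi u) A = mu A) /\
  mutually_independent xi.

(* Measurability is part of the notion: the value of [P] at a set that is not
   measurable is meaningless. *)
Definition cvg_in_probability (X : nat -> T -> R) (l : R) : Prop :=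
  (forall n, measurable_fun setT (X n)) /\
  (forall eps : R, 0 < eps ->
    P [set t | eps <= `|X n t - l|] @[n --> \oo] --> 0%E).

End Probability.

(* Main.v *)
Require Import Defs.
From HB Require Import structures.
From mathcomp Require Import all_boot all_order all_algebra.
From mathcomp Require Import all_classical all_reals all_analysis.
From mathcomp Require Import measurable_realfun ring lra zify.

Set Implicit Arguments.
Unset Strict Implicit.
Unset Printing Implicit Defensive.

Import Order.TTheory GRing.Theory Num.Theory.
Import numFieldNormedType.Exports.

Local Open Scope classical_set_scope.
Local Open Scope ring_scope.

(** Write [s = psi q beta], which lies in (0, 1), and let [x_1], ..., [x_k] be
    the connection probabilities in the subtrees of the children of the root.
    The weight of a configuration is a product over the branches at the root,
    up to the factor [q] of the root's own cluster; hence, with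
    [h x = (1 + (q - 1) s x) / (1 - s x)] and [y] the product of the [h x_i],
    the connection probability at the root is [(y - 1) / (y - 1 + q)]
    ([root_connectionE]).  To first order this is [s] times the sum of the
    [x_i], so that [pi_n] should decay like [(m s) ^ n].

    Upper bound.  For [q <= 2] the right-hand side is subadditive in the
    branches and is at most [s] times the sum of the [x_i]
    ([tree_connection_le]).  So the expectation of [pi_n] is at most
    [(m s) ^ n] ([expected_connection]), and Markov's inequality applies.

    Lower bound.  For every [q > 0] the right-hand side is at least
    [S / (1 + S)], where [S] is [s] times the sum of the [x_i]
    ([tree_connection_ge]).  Iterating [S / (1 + S)] from a small boundary value
    [delta], and on the tree in which only the first [K] children of each vertex
    are kept, gives a lower bound for [pi_n] with bounded offspring numbers.  Let
    [rho = s E(min(Z, K))], which is as close to [m s] as desired.  As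
    [S / (1 + S)] lies between [S - S ^ 2] and [S], and [s < rho < 1], the first
    two moments of this lower bound are of orders [rho ^ n] and [rho ^ (2 n)]
    ([mean_flow_ge], [mean_flow_sq_le]): the lower bound on the first one is
    ensured by the choice of [delta], because the losses [S ^ 2], relative to
    [rho ^ n], are summable and quadratic in [delta].  By the Paley-Zygmund
    inequality the lower bound exceeds a multiple of [rho ^ n] with a probability
    bounded away from 0 ([mean_flow_small]).  This probability is pushed
    towards 1 by going back [j] generations: a small value at the root forces
    small values in the independent subtrees of all its children, and there are
    at least two children with positive probability ([mean_flow_small_step]).
    This costs a constant factor per generation, harmless after taking [n]-th
    roots.

    Two expectations of independent variables with finitely many values occur,
    one over the states of the edges, the other over the truncated offspring
    numbers; [product_law] covers both. *)

(** * Independence of finitely many coordinates *)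

Section FiniteIndependence.
Variables (R : realType) (W : eqType) (V : finType).
Implicit Types (s r : seq W) (F G : (W -> V) -> R).

(** The list [s] may contain more coordinates than [F] uses, and repetitions. *)
Definition depends_on s F :=
  forall c c' : W -> V, {in s, c =1 c'} -> F c = F c'.

Definition update (c : W -> V) (u : W) (k : V) : W -> V :=
  fun x => if x == u then k else c x.

Lemma depends_on_sub s r F :
  {subset s <= r} -> depends_on s F -> depends_on r F.
Proof. by move=> sr dF c c' e; apply: dF => u /sr; apply: e. Qed.

Lemma depends_on_cst s (a : R) : depends_on s (fun=> a).
Proof. by []. Qed.

Lemma depends_on_comp s (h : R -> R) F :
  depends_on s F -> depends_on s (fun c => h (F c)).
Proof. by move=> dF c c' e; rewrite (dF c c'). Qed.

Lemma depends_on_comp2 s (h : R -> R -> R) F G :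
  depends_on s F -> depends_on s G -> depends_on s (fun c => h (F c) (G c)).
Proof. by move=> dF dG c c' e; rewrite (dF c c') // (dG c c'). Qed.

Lemma depends_on_sum (I : Type) (t : seq I) s (F : I -> (W -> V) -> R) :
  (forall i, depends_on s (F i)) ->
  depends_on s (fun c => \sum_(i <- t) F i c).
Proof. by move=> dF c c' e; apply: eq_bigr => i _; apply: dF. Qed.

Lemma depends_on_coord s (f : V -> R) u :
  u \in s -> depends_on s (fun c => f (c u)).
Proof. by move=> us c c' ->. Qed.

Lemma depends_on_update s F u k : depends_on (u :: s) F ->
  depends_on s (fun c => F (update c u k)).
Proof.
move=> dF c c' e; apply: dF => x; rewrite inE /update.
by have [//|_ /= xs] := eqVneq x u; apply: e.
Qed.

Lemma sum_update F u c :
  F c = \sum_(k : V) ((c u == k)%:R * F (update c u k)).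
Proof.
rewrite (bigD1 (c u)) //= eqxx mul1r big1 ?addr0.
  by congr F; apply/funext => x; rewrite /update; case: eqP => [->|].
by move=> k /negbTE; rewrite eq_sym => ->; rewrite mul0r.
Qed.

(** What is used of the expectation for independent coordinates of law [nu].
    Only functions of finitely many coordinates are considered, since others
    need not be measurable when [E] is an integral. *)
Definition product_law (E : ((W -> V) -> R) -> R) (nu : V -> R) :=
  [/\ forall s (F : V -> (W -> V) -> R), (forall k, depends_on s (F k)) ->
        E (fun c => \sum_k F k c) = \sum_k E (F k),
      forall s a F, depends_on s F -> E (fun c => a * F c) = a * E F &
      forall s (a : W -> V), uniq s ->
        E (fun c => \prod_(u <- s) (c u == a u)%:R) = \prod_(u <- s) nu (a u)].

Section ProductLaw.
Variables (E : ((W -> V) -> R) -> R) (nu : V -> R).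
Hypothesis E_law : product_law E nu.

Lemma product_law_cst (v0 : V) a : E (fun=> a) = a.
Proof.
have [_ EZ Er] := E_law.
have := Er [::] (fun=> v0) isT; rewrite big_nil => E1.
rewrite -[RHS]mulr1 -E1 -(EZ [::]); last by move=> c c' _; rewrite !big_nil.
by congr E; apply/funext => c; rewrite big_nil mulr1.
Qed.

Lemma depends_on_nil (v0 : V) F :
  depends_on [::] F -> F = fun=> F (fun=> v0).
Proof. by move=> dF; apply/funext => c; apply: dF. Qed.

Lemma depends_on_rect r (a : W -> V) :
  depends_on r (fun c => \prod_(u <- r) (c u == a u)%:R).
Proof.
by move=> c c' e; apply: eq_big_seq => u ur; rewrite e.
Qed.

(** Fixing the value of one coordinate of [F] turns that coordinate into one
    more side of the rectangle; after all of them, a constant is left. *)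
Lemma product_law_rect (v0 : V) s r (a : W -> V) F :
  uniq r -> ~~ has (mem r) s -> depends_on s F ->
  E (fun c => \prod_(u <- r) (c u == a u)%:R * F c) =
  \prod_(u <- r) nu (a u) * E F.
Proof.
have [Es EZ Er] := E_law.
elim: s r a F => [|u s IH] r a F ur; rewrite /= ?negb_or.
  move=> _ /(depends_on_nil v0) ->; rewrite product_law_cst // mulrC.
  rewrite -(Er _ _ ur) -(EZ r); last exact: depends_on_rect.
  by congr E; apply/funext => c; rewrite mulrC.
move=> /andP[uNr sr] dF.
have [us|uNs] := boolP (u \in s).
  by apply: IH => //; apply: depends_on_sub dF => x; rewrite inE => /predU1P[->|].
have dFk k := depends_on_update k dF.
have step t b (G := fun c => \prod_(x <- t) (c x == b x)%:R) :
    uniq t -> u \notin t -> ~~ has (mem t) s ->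
    E (fun c => G c * F c) =
    \prod_(x <- t) nu (b x) * (\sum_k nu k * E (fun c => F (update c u k))).
  move=> ut uNt st.
  have bk k x : x \in t -> update b u k x = b x.
    by rewrite /update; case: eqP => // ->; rewrite (negbTE uNt).
  have -> : (fun c => G c * F c) = (fun c => \sum_k
      (\prod_(x <- u :: t) (c x == update b u k x)%:R * F (update c u k))).
    apply/funext => c; rewrite (sum_update F u c) mulr_sumr.
    apply: eq_bigr => k _; rewrite big_cons {2}/update eqxx.
    rewrite mulrCA mulrA; congr (_ * _ * _).
    by apply: eq_big_seq => x xt; rewrite bk.
  rewrite (Es (u :: t ++ s)); last first.
    move=> k; apply: depends_on_comp2.
      by apply: depends_on_sub (@depends_on_rect _ _) => x; 
        rewrite !(inE, mem_cat) => /orP[] ->; rewrite ?orbT.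
    by apply: depends_on_sub (dFk k) => x xs; rewrite inE mem_cat xs !orbT.
  rewrite mulr_sumr; apply: eq_bigr => k _.
  rewrite IH //=; last 2 first.
  - by rewrite uNt.
  - apply/hasPn => x xs; rewrite /= inE negb_or (hasPn st) // andbT.
    by apply: contraNneq uNs => <-.
  rewrite big_cons {1}/update eqxx mulrCA mulrA; congr (_ * _ * _).
  by apply: eq_big_seq => x xt; rewrite bk.
rewrite step //.
have := step [::] a isT isT; rewrite big_nil mul1r => <-.
  by congr (_ * E _); apply/funext => c; rewrite big_nil mul1r.
by apply/hasPn.
Qed.

Lemma product_law_coord (v0 : V) u s (k : V) F :
  u \notin s -> depends_on s F ->
  E (fun c => (c u == k)%:R * F c) = nu k * E F.
Proof.
move=> us dF; have /= := @product_law_rect v0 s [:: u] (fun=> k) F isT.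
rewrite big_seq1 => <- //.
  by congr E; apply/funext => c; rewrite big_seq1.
by apply/hasPn => x; rewrite /= inE; apply: contraTneq => ->.
Qed.

(** Split [F] according to the value of one of its coordinates at a time. *)
Lemma product_law_indep (v0 : V) s r F G :
  ~~ has (mem r) s -> depends_on s F -> depends_on r G ->
  E (fun c => F c * G c) = E F * E G.
Proof.
have [Es EZ _] := E_law.
elim: s F => [|u s IH] F /=.
  move=> _ /(depends_on_nil v0) -> dG.
  by rewrite product_law_cst // (EZ r).
rewrite negb_or => /andP[uNr sr] dF dG.
have [us|uNs] := boolP (u \in s).
  by apply: IH => //; apply: depends_on_sub dF => x; rewrite inE => /predU1P[->|].
have dFk k := depends_on_update k dF.
have decomp (H : (W -> V) -> R) : depends_on r H ->
    E (fun c => F c * H c) = \sum_k nu k * E (fun c => F (update c u k) * H c).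
  move=> dH.
  have dFH k : depends_on (s ++ r) (fun c => F (update c u k) * H c).
    apply: depends_on_comp2.
      by apply: depends_on_sub (dFk k) => x xs; rewrite mem_cat xs.
    by apply: depends_on_sub dH => x xr; rewrite mem_cat xr orbT.
  have -> : (fun c => F c * H c) =
      (fun c => \sum_k (c u == k)%:R * (F (update c u k) * H c)).
    apply/funext => c; rewrite (sum_update F u c) mulr_suml.
    by apply: eq_bigr => k _; rewrite mulrA.
  rewrite (Es (u :: (s ++ r))); last first.
    move=> k; apply: depends_on_comp2; last first.
      by apply: depends_on_sub (dFH k) => x xs; rewrite inE xs orbT.
    by apply: (@depends_on_coord _ (fun v => (v == k)%:R)); rewrite mem_head.
  apply: eq_bigr => k _; apply: (@product_law_coord v0 _ (s ++ r)) => //.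
  by rewrite mem_cat negb_or uNs.
rewrite decomp //; have := decomp (fun=> 1) (@depends_on_cst _ _).
have -> : (fun c => F c * 1) = F by apply/funext => c; rewrite mulr1.
move=> ->; rewrite mulr_suml; apply: eq_bigr => k _.
rewrite -mulrA; congr (_ * _); rewrite IH //; congr (E _ * _).
by apply/funext => c; rewrite mulr1.
Qed.

End ProductLaw.
End FiniteIndependence.

(** * Independent states of the edges *)

Section Bernoulli.
Variables (R : realType) (p : R) (I : finType).

Definition bernoulli_weight (b : bool) : R := if b then p else 1 - p.

Definition bernoulli_mean (F : (I -> bool) -> R) : R :=
  \sum_(w : {ffun I -> bool}) (\prod_i bernoulli_weight (w i) * F w).

Lemma bernoulli_law : product_law bernoulli_mean bernoulli_weight.
Proof.
split=> [s F _|s a F _|s a us].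
- rewrite exchange_big; apply: eq_bigr => w _.
  by rewrite mulr_sumr.
- by rewrite mulr_sumr; apply: eq_bigr => w _; rewrite mulrCA.
- rewrite /bernoulli_mean.
  pose f i b := bernoulli_weight b * (if i \in s then (b == a i)%:R else 1).
  transitivity (\sum_(w : {ffun I -> bool}) \prod_i f i (w i)).
    apply: eq_bigr => w _; rewrite big_split /=; congr (_ * _).
    by rewrite -big_mkcond /= -big_uniq.
  rewrite -(@bigA_distr_bigA R 0 1 *%R +%R I bool f).
  rewrite [RHS]big_uniq // [RHS]big_mkcond /=.
  apply: eq_bigr => i _; rewrite /f big_bool /bernoulli_weight.
  by case: (i \in s); case: (a i) => /=; ring.
Qed.

Lemma eq_bernoulli_mean (F G : (I -> bool) -> R) : (forall w : {ffun I -> bool}, F w = G w) ->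
  bernoulli_mean F = bernoulli_mean G.
Proof. by move=> e; apply: eq_bigr => w _; rewrite e. Qed.

Lemma bernoulli_meanD F G :
  bernoulli_mean (fun w => F w + G w) = bernoulli_mean F + bernoulli_mean G.
Proof. by rewrite -big_split; apply: eq_bigr => w _; rewrite mulrDr. Qed.

Lemma bernoulli_meanZ a F :
  bernoulli_mean (fun w => a * F w) = a * bernoulli_mean F.
Proof. by rewrite mulr_sumr; apply: eq_bigr => w _; rewrite mulrCA. Qed.

Lemma bernoulli_mean_ge0 F : 0 <= p <= 1 -> (forall w, 0 <= F w) ->
  0 <= bernoulli_mean F.
Proof.
move=> /andP[p0 p1] F0; apply: sumr_ge0 => w _; apply: mulr_ge0 => //.
by apply: prodr_ge0 => i _; rewrite /bernoulli_weight; case: ifP; rewrite ?subr_ge0.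
Qed.

Lemma bernoulli_mean_gt0 F : 0 < p < 1 -> (forall w, 0 < F w) ->
  0 < bernoulli_mean F.
Proof.
move=> /andP[p0 p1] F0; rewrite /bernoulli_mean (bigD1 [ffun=> true]) //=.
have pos (w : {ffun I -> bool}) : 0 < \prod_i bernoulli_weight (w i) * F w.
  apply: mulr_gt0 => //; apply: prodr_gt0 => i _.
  by rewrite /bernoulli_weight; case: ifP; rewrite ?subr_gt0.
by apply: ltr_pwDl => //; apply: sumr_ge0 => w _; apply/ltW/pos.
Qed.

Lemma bernoulli_mean_prod (J : eqType) (t : seq J) (L : J -> seq I)
    (F : J -> (I -> bool) -> R) :
  uniq t -> (forall j, j \in t -> depends_on (L j) (F j)) ->
  {in t &, forall j k, j != k -> ~~ has (mem (L k)) (L j)} ->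
  bernoulli_mean (fun w => \prod_(j <- t) F j w) =
  \prod_(j <- t) bernoulli_mean (F j).
Proof.
have law := bernoulli_law.
elim: t => [|j t IH] /=.
  move=> _ _ _; rewrite big_nil -[RHS](product_law_cst law true).
  by apply: eq_bernoulli_mean => w; rewrite big_nil.
move=> /andP[jt ut] dF dis; rewrite big_cons -IH //; last 2 first.
- by move=> k kt; apply: dF; rewrite inE kt orbT.
- by move=> k l kt lt; apply: dis; rewrite inE ?kt ?lt orbT.
pose r := flatten [seq L k | k <- t].
rewrite -(product_law_indep law true (s := L j) (r := r)).
- by apply: eq_bernoulli_mean => w; rewrite big_cons.
- apply/hasPn => e eL; apply/negP => /flattenP[_ /mapP[k kt ->]] ek.
  have jk : j != k by apply: contraNneq jt => ->.
  have := dis j k; rewrite !inE eqxx kt orbT => /(_ isT isT jk) /hasPn /(_ e eL).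
  by rewrite /= ek.
- by apply: dF; rewrite mem_head.
- move=> c c' e; apply: eq_big_seq => k kt; apply: (dF k); first by rewrite inE kt orbT.
  by move=> x xk; apply: e; apply/flattenP; exists (L k) => //; apply: map_f.
Qed.

End Bernoulli.

(** * Clusters of a percolated tree *)

(** A function that picks in each component one of its points, the same for
    the whole component, counts the components by its fixed points. *)
Lemma n_comp_rep (T : finType) (e : rel T) (rep : T -> T) :
  connect_sym e -> (forall x, connect e x (rep x)) ->
  (forall x y, e x y -> rep x = rep y) ->
  n_comp e predT = #|[pred x | rep x == x]|.
Proof.
move=> sym_e c_rep e_rep.
have c_eq x y : connect e x y -> rep x = rep y.
  move=> /connectP[s es ->]; elim: s x es => //= z s IH x /andP[xz /IH <-].
  exact: e_rep.
have inj : {in [predI roots e & predT] &, injective rep}.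
  move=> x y; rewrite !inE !andbT => /eqP rx /eqP ry rxy; rewrite -rx -ry.
  apply/eqP; rewrite (root_connect sym_e); apply: connect_trans (c_rep x) _.
  by rewrite rxy sym_e c_rep.
rewrite /n_comp_mem -(card_in_image inj); apply: eq_card => x; rewrite [RHS]inE.
apply/fintype.imageP/eqP => [[y _ ->]|rx]; first by rewrite -(c_eq _ _ (c_rep y)).
exists (fingraph.root e x); first by rewrite !inE andbT; apply: (roots_root sym_e).
by rewrite -(c_eq _ _ (connect_root e x)).
Qed.

Section Tree.
Variable c : seq nat -> nat.

Lemma size_generation n u : u \in generation c n -> size u = n.
Proof.
elim: n u => [|n IH] u /=; first by rewrite inE => /eqP ->.
by move=> /allpairsPdep[v [i [/IH sv _ ->]]]; rewrite size_rcons sv.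
Qed.

Lemma mem_generation_rcons n u i :
  (rcons u i \in generation c n.+1) = (u \in generation c n) && (i < c u)%N.
Proof.
apply/allpairsPdep/andP => /= [[v [j [vn jv /rcons_inj[-> ->]]]]|[un iu]].
  by split=> //; rewrite mem_iota in jv.
by exists u, i; rewrite mem_iota.
Qed.

Lemma generation_uniq n : uniq (generation c n).
Proof.
elim: n => //= n IH; apply: allpairs_uniq_dep => // [u _|]; first exact: iota_uniq.
move=> [u i] [v j] _ _ /= /rcons_inj[-> ->] //.
Qed.

Lemma mem_tree_vertices n u :
  (u \in tree_vertices c n) = (u \in generation c (size u)) && (size u <= n)%N.
Proof.
apply/flatten_mapP/andP => [[k]|[un sn]].
  by rewrite mem_iota => kn uk; rewrite (size_generation uk).
by exists (size u) => //; rewrite mem_iota.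
Qed.

Lemma tree_verticesS n :
  tree_vertices c n.+1 = tree_vertices c n ++ generation c n.+1.
Proof.
by rewrite /tree_vertices -addn1 iotaD map_cat flatten_cat add0n /= cats0.
Qed.

Lemma tree_vertices_uniq n : uniq (tree_vertices c n).
Proof.
elim: n => // n IH; rewrite tree_verticesS cat_uniq IH generation_uniq andbT.
apply/hasPn => u ug; have su := size_generation ug; rewrite mem_tree_vertices su.
by rewrite ltnn andbF.
Qed.

Section Configuration.
(** An edge is named after its lower end: [o u] is the state of the edge from
    [u] to its parent. *)
Variable o : seq nat -> bool.

Fixpoint linked n v :=
  if n is k.+1 then
    has (fun i => o (rcons v i) && linked k (rcons v i)) (iota 0 (c v))
  else true.

(** The number of clusters that lie strictly below [v], do not contain [v] and
    do not reach depth [n] below [v]: each is counted at its highest vertex,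
    which is cut from its parent. *)
Fixpoint isolated n v : nat :=
  if n is k.+1 then
    \sum_(i <- iota 0 (c v))
      (isolated k (rcons v i) + (~~ o (rcons v i) && ~~ linked k (rcons v i)))%N
  else 0.

(** The highest vertex reached from [v] by open edges.  The fold walks from the
    root to [v] and keeps in its second component the last vertex met whose edge
    to its parent is closed, or the root. *)
Definition cluster_top v : seq nat :=
  (foldl (fun s i => let u := rcons s.1 i in (u, if o u then s.2 else u))
    ([::], [::]) v).2.

Lemma cluster_top_nil : cluster_top [::] = [::]. Proof. by []. Qed.

Lemma cluster_top_rcons v i :
  cluster_top (rcons v i) = if o (rcons v i) then cluster_top v else rcons v i.
Proof.
rewrite /cluster_top foldl_rcons /=; set s := foldl _ _ _.
suff -> : s.1 = v by [].
rewrite /s; elim/last_ind: v {s} => // v j IH.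
by rewrite foldl_rcons /= IH.
Qed.

Lemma cluster_top_generation v : v \in generation c (size v) ->
  cluster_top v \in generation c (size (cluster_top v)).
Proof.
elim/last_ind: v => // v i IH vi; rewrite cluster_top_rcons; case: ifP => // _.
by move: vi; rewrite size_rcons mem_generation_rcons => /andP[/IH].
Qed.

Lemma size_top v : (size (cluster_top v) <= size v)%N.
Proof.
elim/last_ind: v => // v i IH; rewrite cluster_top_rcons.
by case: ifP => // _; rewrite size_rcons leqW.
Qed.

Lemma cluster_top_id v : (cluster_top v == v) = (v == [::]) || ~~ o v.
Proof.
case: (lastP v) => // {}v i; rewrite cluster_top_rcons.
have -> : (rcons v i == [::]) = false by case: (v).
case: ifP => oi; rewrite ?eqxx //=; apply/eqP => /(congr1 size) e.
by have := size_top v; rewrite e size_rcons ltnn.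
Qed.

Lemma linked_up n v : v \in generation c (size v) -> (size v <= n)%N ->
  linked (n - size v) v -> linked (n - size (cluster_top v)) (cluster_top v).
Proof.
elim/last_ind: v => // v i IH vi; rewrite cluster_top_rcons; case: ifP => // oi.
move: vi; rewrite size_rcons mem_generation_rcons => /andP[vg iv] vn lv.
apply: IH => //; first exact: ltnW.
have -> : (n - size v = (n - (size v).+1).+1)%N by lia.
by apply/hasP; exists i; rewrite ?mem_iota // oi.
Qed.

End Configuration.
End Tree.

(** * Clusters of the wired tree *)

Section WiredTree.
Variables (c : seq nat -> nat) (N : nat).
Local Notation V := (vertex (wired_tree c N)).
Local Notation E := (edge (wired_tree c N)).

Definition parent_word (e : E) : seq nat := ssval (val e).1.
Definition child_word (e : E) : seq nat := ssval (val e).2.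

Lemma child_wordE (e : E) :
  exists2 i, child_word e = rcons (parent_word e) i & (i < c (parent_word e))%N.
Proof.
rewrite /child_word /parent_word; case: e => -[[u uN] [v vN]] /= /andP[].
move=> /prefixP[s vE]; move: vN; rewrite {}vE size_cat.
case: s => [|i [|j s]] /= vN /eqP; [lia| |lia]; move=> _.
move: vN; rewrite cats1 mem_tree_vertices size_rcons mem_generation_rcons.
by move=> /andP[/andP[_ iu] _]; exists i.
Qed.

Lemma child_word_tree e : child_word e \in tree_vertices c N.
Proof. exact: ssvalP. Qed.

Lemma parent_word_tree e : parent_word e \in tree_vertices c N.
Proof. exact: ssvalP. Qed.

Lemma child_word_inj : injective child_word.
Proof.
move=> e f ef; have [i ei _] := child_wordE e; have [j fj _] := child_wordE f.
have := ef; rewrite ei fj => /rcons_inj[pf _].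
apply/val_inj; move: ef pf; rewrite /child_word /parent_word.
case: (val e) (val f) => [a b] [a' b'] /= bb aa.
by congr pair; apply/val_inj.
Qed.

Lemma edge_exists u i : rcons u i \in tree_vertices c N ->
  exists e, child_word e = rcons u i.
Proof.
move=> vN; have uN : u \in tree_vertices c N.
  move: vN; rewrite !mem_tree_vertices size_rcons mem_generation_rcons.
  by move=> /andP[/andP[-> _] /ltnW].
have ch : is_child (val (SeqSub uN)) (val (SeqSub vN)).
  by rewrite /is_child /= -cats1 prefix_prefix size_cat addn1 eqxx.
by exists (exist _ (SeqSub uN, SeqSub vN) ch).
Qed.

(** The vertex of the wired tree to which a word is sent; the boundary, and
    also every word outside the tree, goes to [None]. *)
Definition wired_vertex (u : seq nat) : V :=
  if insub u is Some x then insub (x : seq_sub (tree_vertices c N)) else None.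

Lemma wired_vertex_ssval (x : seq_sub (tree_vertices c N)) :
  wired_vertex (ssval x) = insub x.
Proof. by rewrite /wired_vertex (valK x). Qed.

Lemma wired_vertex_interior u : u \in tree_vertices c N -> (size u < N)%N ->
  exists2 y : {v | ~~ @tree_boundary c N v},
    wired_vertex u = Some y & ssval (val y) = u.
Proof.
move=> uN su; have bu : ~~ @tree_boundary c N (SeqSub uN).
  by rewrite /tree_boundary /= neq_ltn su.
exists (exist (fun v => ~~ @tree_boundary c N v) _ bu) => //.
by rewrite /wired_vertex insubT /= insubT.
Qed.

Lemma wired_vertex_boundary u : size u = N -> wired_vertex u = None.
Proof.
move=> su; rewrite /wired_vertex; case: insubP => // x _ xu.
by rewrite insubN // /tree_boundary /= negbK -[ssval x]/(val x) xu su.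
Qed.

Lemma vertex_word (x : {v | ~~ @tree_boundary c N v}) :
  [/\ ssval (val x) \in tree_vertices c N, (size (ssval (val x)) < N)%N &
      wired_vertex (ssval (val x)) = Some x].
Proof.
have xN : ssval (val x) \in tree_vertices c N by exact: ssvalP.
split=> //; last by rewrite wired_vertex_ssval valK.
rewrite ltn_neqAle (valP x); move: xN.
by rewrite mem_tree_vertices => /andP[].
Qed.

Lemma ends_wired (e : E) :
  ends e = (wired_vertex (parent_word e), wired_vertex (child_word e)).
Proof. by rewrite !wired_vertex_ssval. Qed.

Definition edge_state (w : E -> bool) (u : seq nat) : bool :=
  [exists e, w e && (child_word e == u)].

Lemma edge_state_child w e : edge_state w (child_word e) = w e.
Proof.
apply/existsP/idP => [[f /andP[wf /eqP /child_word_inj <-]] //|we].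
by exists e; rewrite we eqxx.
Qed.

Section Configuration.
Variable w : {ffun E -> bool}.

Local Notation linked := (linked c (edge_state w)).
Local Notation isolated := (isolated c (edge_state w)).
Local Notation cluster_top := (cluster_top (edge_state w)).

Lemma open_adj_sym : symmetric (open_adj w).
Proof.
by move=> x y; apply/eq_existsb => e; rewrite orbC.
Qed.

Lemma open_adj_word u i : rcons u i \in tree_vertices c N ->
  (edge_state w) (rcons u i) ->
  open_adj w (wired_vertex u) (wired_vertex (rcons u i)).
Proof.
move=> /edge_exists[e ei]; rewrite -ei edge_state_child => we.
have [j ej _] := child_wordE e; move: (ej); rewrite {1}ei => /rcons_inj[-> _].
by apply/existsP; exists e; rewrite we ends_wired eqxx.
Qed.

Lemma connect_top u : u \in tree_vertices c N ->
  connect (open_adj w) (wired_vertex u) (wired_vertex (cluster_top u)).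
Proof.
elim/last_ind: u => // u i IH uiN; rewrite cluster_top_rcons; case: ifP => // oi.
apply: (@connect_trans _ _ (wired_vertex u)).
  by rewrite (sym_connect_sym open_adj_sym) connect1 // open_adj_word.
apply: IH; move: uiN; rewrite !mem_tree_vertices size_rcons mem_generation_rcons.
by move=> /andP[/andP[-> _] /ltnW].
Qed.

Lemma linked_connect n u : (size u + n)%N = N -> u \in tree_vertices c N ->
  linked n u -> connect (open_adj w) (wired_vertex u) None.
Proof.
elim: n u => [|n IH] u /=; first by rewrite addn0 => /wired_vertex_boundary ->.
move=> su uN /hasP[i]; rewrite mem_iota /= => iu /andP[oi lu].
have uiN : rcons u i \in tree_vertices c N.
  move: uN; rewrite !mem_tree_vertices size_rcons mem_generation_rcons.
  by move=> /andP[-> _] /=; lia.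
apply: (connect_trans (connect1 (open_adj_word uiN oi))).
by apply: IH => //; rewrite size_rcons addSnnS.
Qed.

(** A canonical vertex in each cluster: the boundary if the cluster touches it,
    its highest vertex otherwise. *)
Definition cluster_rep (x : V) : V :=
  if x is Some y then
    let u := cluster_top (ssval (val y)) in
    if linked (N - size u) u then None else wired_vertex u
  else None.

Lemma cluster_rep_word u : u \in tree_vertices c N ->
  cluster_rep (wired_vertex u) =
    if linked (N - size (cluster_top u)) (cluster_top u) then None
    else wired_vertex (cluster_top u).
Proof.
move=> uN; have [ug] := andP (etrans (esym (mem_tree_vertices c N u)) uN).
rewrite leq_eqVlt => /predU1P[su|su].
  have lu : linked (N - size u) u by rewrite su subnn.
  by rewrite wired_vertex_boundary //= linked_up // su.
have [y yE yu] := wired_vertex_interior uN su.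
by rewrite yE /= yu.
Qed.

(** If the edge between [u] and its child is open, both have the same top; if
    moreover the child is on the boundary, then that top is linked to it. *)
Lemma cluster_rep_adj x y : open_adj w x y -> cluster_rep x = cluster_rep y.
Proof.
suff H e : w e -> cluster_rep (wired_vertex (parent_word e)) =
                  cluster_rep (wired_vertex (child_word e)).
  move=> /existsP[e /andP[we]]; rewrite ends_wired.
  by move=> /orP[] /eqP[<- <-]; rewrite H.
move=> we; rewrite !cluster_rep_word ?child_word_tree ?parent_word_tree //.
have [i ei _] := child_wordE e.
by rewrite ei cluster_top_rcons -ei edge_state_child we.
Qed.

Lemma cluster_top_tree u : u \in tree_vertices c N -> cluster_top u \in tree_vertices c N.
Proof.
rewrite !mem_tree_vertices => /andP[/cluster_top_generation-> uN] /=.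
exact: leq_trans (size_top _ _) uN.
Qed.

Lemma connect_cluster_rep x : connect (open_adj w) x (cluster_rep x).
Proof.
case: x => [x|] //=; have [xN sx xE] := vertex_word x.
have := connect_top xN; rewrite xE => xtop.
case: ifP => // lx; apply: connect_trans xtop _.
apply: linked_connect lx; last exact: cluster_top_tree.
by rewrite subnKC // (leq_trans (size_top _ _) (ltnW sx)).
Qed.

Lemma connect_rep_eq x y : connect (open_adj w) x y ->
  cluster_rep x = cluster_rep y.
Proof.
move=> /connectP[s es ->]; elim: s x es => //= z s IH x /andP[xz /IH <-].
exact: cluster_rep_adj.
Qed.

Lemma wired_rootE : wired_root c N = wired_vertex [::].
Proof. by rewrite /wired_root -wired_vertex_ssval. Qed.

Lemma nil_tree : [::] \in tree_vertices c N.
Proof. exact: root_subproof. Qed.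

Lemma connect_root_boundary :
  connect (open_adj w) (wired_root c N) (wired_boundary c N) = linked N [::].
Proof.
rewrite wired_rootE; apply/idP/idP; last first.
  by apply: linked_connect => //; apply: nil_tree.
move=> /connect_rep_eq; rewrite cluster_rep_word ?nil_tree // cluster_top_nil /= subn0.
case: ifP => // lN; have [N0|N0] := posnP N.
  by have : linked N [::] by [move: (edge_state w) => o; rewrite N0]; rewrite lN.
have [y yE _] := wired_vertex_interior nil_tree N0.
by rewrite yE.
Qed.

(** Unfolding the recursion along the first [j] generations. *)
Lemma isolated_sum j : (j <= N)%N -> isolated N [::] =
  (\sum_(1 <= k < j.+1) \sum_(u <- generation c k)
     (~~ (edge_state w) u && ~~ linked (N - k) u)
   + \sum_(u <- generation c j) isolated (N - j) u)%N.
Proof.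
elim: j => [|j IH] jN; first by rewrite big_geq // subn0 /= big_seq1.
rewrite (IH (ltnW jN)) (big_nat_recr j.+1) //= -!addnA; congr addn.
have -> : (N - j = (N - j.+1).+1)%N by lia.
rewrite !big_allpairs_dep -big_split /=; apply: eq_bigr => u _.
by rewrite -big_split; apply: eq_bigr => i _; rewrite addnC.
Qed.

Lemma wired_vertex_inj : {in [pred u | u \in tree_vertices c N & (size u < N)%N] &,
  injective wired_vertex}.
Proof.
move=> u v /andP[uN su] /andP[vN sv].
have [y -> <-] := wired_vertex_interior uN su.
have [z -> <-] := wired_vertex_interior vN sv.
by case=> ->.
Qed.

Definition isolated_top u := (cluster_top u == u) && ~~ linked (N - size u) u.

Lemma isolated_top_size u : u \in tree_vertices c N -> isolated_top u ->
  (size u < N)%N.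
Proof.
rewrite mem_tree_vertices => /andP[_]; rewrite leq_eqVlt => /predU1P[su|//].
by rewrite /isolated_top su subnn /= andbF.
Qed.

Lemma cluster_rep_fixed u : u \in tree_vertices c N -> (size u < N)%N ->
  (cluster_rep (wired_vertex u) == wired_vertex u) = isolated_top u.
Proof.
move=> uN su; rewrite cluster_rep_word // /isolated_top.
have [y yE _] := wired_vertex_interior uN su.
case: ifPn => lt.
  by rewrite yE; case: (cluster_top u =P u) => // <-; rewrite lt.
have st : (size (cluster_top u) < N)%N by apply: leq_ltn_trans (size_top _ _) su.
rewrite (inj_in_eq wired_vertex_inj).
- by case: eqP => // <-; rewrite lt.
- by apply/andP; rewrite cluster_top_tree.
- exact/andP.
Qed.

(** Besides the cluster of the boundary, the clusters correspond to the vertices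
    which are tops of their clusters and not linked to the boundary: possibly the
    root, and the vertices counted by [isolated]. *)
Lemma num_clusters_wired :
  num_clusters w = (1 + (~~ linked N [::] + isolated N [::]))%N.
Proof.
rewrite /num_clusters (n_comp_rep (sym_connect_sym open_adj_sym)
  connect_cluster_rep cluster_rep_adj).
transitivity (1 + count isolated_top (tree_vertices c N))%N.
  rewrite (cardD1 None) inE eqxx; congr addn.
  rewrite -size_filter -(size_map wired_vertex); set s := map _ _.
  have us : uniq s.
    rewrite map_inj_in_uniq; first by apply: filter_uniq; apply: tree_vertices_uniq.
    move=> u v.
    rewrite !mem_filter => /andP[uP uN] /andP[vP vN].
    by apply: wired_vertex_inj; apply/andP; rewrite isolated_top_size.
  rewrite -(card_uniqP us); apply: eq_card => x; rewrite !inE.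
  apply/andP/mapP => [[x0 /eqP rx]|[u]].
    case: x x0 rx => // x _ rx; have [xN sx xE] := vertex_word x.
    exists (ssval (val x)) => //; rewrite mem_filter xN andbT.
    by rewrite -cluster_rep_fixed // xE rx.
  rewrite mem_filter => /andP[uP uN] ->; have su := isolated_top_size uN uP.
  by rewrite cluster_rep_fixed //; have [y -> _] := wired_vertex_interior uN su.
have -> : tree_vertices c N =
    flatten [seq generation c k | k <- 0%N :: index_iota 1 N.+1].
  by rewrite /index_iota subn1.
rewrite count_flatten -map_comp sumnE big_map big_cons (isolated_sum (leqnn N)).
congr addn; congr addn.
  by rewrite /= addn0 /isolated_top eqxx /= subn0.
rewrite [X in (_ + X)%N]big1 ?addn0; last by move=> u _; rewrite subnn.
apply: eq_big_seq => k; rewrite mem_index_iota => /andP[k0 _].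
rewrite /= -sum1_count big_mkcond /=; apply: eq_big_seq => u ug.
have su := size_generation ug.
rewrite /isolated_top cluster_top_id su; case: eqP => [u0|] /=.
  by move: su k0; rewrite u0 => <-.
by case: (_ && _).
Qed.

End Configuration.
End WiredTree.

(** * The recursion for the connection probability *)

Section ConnectionRecursion.
Variable R : realType.

(** The factor by which a branch multiplies the ratio of the total weight to
    the weight of the configurations that do not connect the root to the
    boundary, when [x] is the connection probability in the subtree at the other
    end of the branch: see [odds_ratio_branch]. *)
Definition odds_ratio (q s x : R) : R := (1 + (q - 1) * s * x) / (1 - s * x).

Fixpoint tree_connection (q s : R) (n : nat) (c : seq nat -> nat) : R :=
  if n is k.+1 then
    let y := \prod_(i <- iota 0 (c [::]))
      odds_ratio q s (tree_connection q s k (fun u => c (i :: u))) in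
    (y - 1) / (y - 1 + q)
  else 1.

Section Weights.
Variables (p q : R) (c : seq nat -> nat) (N : nat).
Hypotheses (p01 : 0 < p < 1) (q_gt0 : 0 < q).
Local Notation E := (edge (wired_tree c N)).
Local Notation mean := (@bernoulli_mean R p E).

(** The edges in the subtree of [v]; [branch_edges] has also the edge above
    [v]. *)
Definition edges_below (v : seq nat) : seq E :=
  [seq e <- enum E | prefix v (child_word e) & child_word e != v].

Definition branch_edges (v : seq nat) : seq E :=
  [seq e <- enum E | prefix v (child_word e)].

Lemma edge_state_below (w w' : E -> bool) v i : {in edges_below v, w =1 w'} ->
  edge_state w (rcons v i) = edge_state w' (rcons v i).
Proof.
move=> ww; apply: eq_existsb => e; case: eqP => [ei|]; rewrite ?andbF //.
rewrite ww // mem_filter mem_enum andbT ei -cats1 prefix_prefix /=.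
by apply/eqP => /(congr1 size); rewrite size_cat addn1 => /eqP; rewrite gtn_eqF.
Qed.

Lemma edges_below_rcons v i : {subset edges_below (rcons v i) <= edges_below v}.
Proof.
move=> e; rewrite !mem_filter => /andP[/andP[pe ne] ->]; rewrite andbT.
case/prefixP: pe => s es; rewrite es cat_rcons prefix_prefix /=.
by apply/eqP => /(congr1 size); rewrite size_cat /= => /eqP; lia.
Qed.

Lemma linked_below n v (w w' : E -> bool) : {in edges_below v, w =1 w'} ->
  linked c (edge_state w) n v = linked c (edge_state w') n v.
Proof.
elim: n v => //= n IH v ww; apply: eq_in_has => i _.
rewrite (edge_state_below _ ww); congr (_ && _); apply: IH => e /edges_below_rcons.
exact: ww.
Qed.

Lemma isolated_below n v (w w' : E -> bool) : {in edges_below v, w =1 w'} ->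
  isolated c (edge_state w) n v = isolated c (edge_state w') n v.
Proof.
elim: n v => //= n IH v ww; apply: eq_bigr => i _.
have ww' : {in edges_below (rcons v i), w =1 w'}.
  by move=> e /edges_below_rcons; apply: ww.
by rewrite (edge_state_below _ ww) (linked_below _ ww') (IH _ ww').
Qed.

(** In the next two weights the cluster of [v] itself is not counted. *)
Definition linked_term n v (w : E -> bool) : R :=
  q ^+ isolated c (edge_state w) n v * (linked c (edge_state w) n v)%:R.

Definition unlinked_term n v (w : E -> bool) : R :=
  q ^+ isolated c (edge_state w) n v * (~~ linked c (edge_state w) n v)%:R.

Lemma linked_term_below n v : depends_on (edges_below v) (linked_term n v).
Proof.
by move=> w w' ww; rewrite /linked_term (linked_below _ ww) (isolated_below _ ww).
Qed.

Lemma unlinked_term_below n v : depends_on (edges_below v) (unlinked_term n v).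
Proof.
by move=> w w' ww; rewrite /unlinked_term (linked_below _ ww) (isolated_below _ ww).
Qed.

Lemma mean_edge v i (F G : (E -> bool) -> R) :
  rcons v i \in tree_vertices c N ->
  depends_on (edges_below (rcons v i)) F ->
  depends_on (edges_below (rcons v i)) G ->
  mean (fun w => if edge_state w (rcons v i) then F w else G w) =
  p * mean F + (1 - p) * mean G.
Proof.
move=> /edge_exists[e <-] dF dG; have law := @bernoulli_law R p E.
have eN : e \notin edges_below (child_word e) by rewrite mem_filter eqxx /= andbF.
rewrite -[p]/(bernoulli_weight p true) -[1 - _]/(bernoulli_weight p false).
rewrite -(product_law_coord law true _ eN dF) -(product_law_coord law true _ eN dG).
rewrite -bernoulli_meanD; apply: eq_bernoulli_mean => w.
by rewrite edge_state_child; case: (w e); rewrite !(mul1r, mul0r, addr0, add0r).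
Qed.

(** The weight of the branch formed by the subtree of [v] and the edge above
    it.  When that edge is closed, the cluster of [v] has become an isolated one
    and contributes its factor [q]; when it is open, the cluster is counted
    further up. *)
Definition branch_term n v (w : E -> bool) : R :=
  if edge_state w v then linked_term n v w + unlinked_term n v w
  else linked_term n v w + q * unlinked_term n v w.

(** The same weight, for configurations in which the branch does not link its
    upper end to the boundary. *)
Definition unlinked_branch_term n v (w : E -> bool) : R :=
  if edge_state w v then unlinked_term n v w
  else linked_term n v w + q * unlinked_term n v w.

Lemma branch_termE n v w : branch_term n v w =
  q ^+ (isolated c (edge_state w) n v
        + (~~ edge_state w v && ~~ linked c (edge_state w) n v)).
Proof.
rewrite /branch_term /linked_term /unlinked_term.
move: (isolated _ _ _ _) (edge_state w v) (linked _ _ _ _) => k [] [] /=;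
  by rewrite ?addn0 ?addn1 ?exprSr; ring.
Qed.

Lemma unlinked_branch_termE n v w : unlinked_branch_term n v w =
  branch_term n v w * (~~ (edge_state w v && linked c (edge_state w) n v))%:R.
Proof.
rewrite /unlinked_branch_term /branch_term /linked_term /unlinked_term.
by move: (q ^+ _) (edge_state w v) (linked _ _ _ _) => a [] [] /=; ring.
Qed.

Lemma isolated_prod n v w :
  q ^+ isolated c (edge_state w) n.+1 v =
  \prod_(i <- iota 0 (c v)) branch_term n (rcons v i) w.
Proof.
rewrite /= expr_sum; apply: eq_bigr => i _; exact/esym/branch_termE.
Qed.

Lemma unlinked_prod n v w : unlinked_term n.+1 v w =
  \prod_(i <- iota 0 (c v)) unlinked_branch_term n (rcons v i) w.
Proof.
rewrite /unlinked_term isolated_prod; under [RHS]eq_bigr do rewrite unlinked_branch_termE.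
rewrite big_split /=; congr (_ * _).
elim: (iota _ _) => [|i t IH]; first by rewrite big_nil.
by rewrite big_cons -IH -natrM mulnb -negb_or.
Qed.

Lemma branch_edges_below v i : {subset edges_below (rcons v i) <= branch_edges (rcons v i)}.
Proof. by move=> e; rewrite !mem_filter => /andP[/andP[-> _] ->]. Qed.

Lemma edge_state_branch (w w' : E -> bool) v : {in branch_edges v, w =1 w'} ->
  edge_state w v = edge_state w' v.
Proof.
move=> ww; apply: eq_existsb => e; case: eqP => [ei|]; rewrite ?andbF //.
by rewrite ww // mem_filter mem_enum andbT ei prefix_refl.
Qed.

Lemma branch_edges_disjoint v i j : i != j ->
  ~~ has (mem (branch_edges (rcons v j))) (branch_edges (rcons v i)).
Proof.
move=> ij; apply/hasPn => e; rewrite mem_filter => /andP[/prefixP[s es] _].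
rewrite /= mem_filter es; apply/negP => /andP[/prefixP[s'] + _].
rewrite !cat_rcons => /eqP; rewrite eqseq_cat // eqxx /= eqseq_cons.
by rewrite (negbTE ij).
Qed.

Lemma mean_prod_branches v (F : nat -> (E -> bool) -> R) :
  (forall i, depends_on (branch_edges (rcons v i)) (F i)) ->
  mean (fun w => \prod_(i <- iota 0 (c v)) F i w) =
  \prod_(i <- iota 0 (c v)) mean (F i).
Proof.
move=> dF; apply: (@bernoulli_mean_prod _ _ _ _ _ (fun i => branch_edges (rcons v i))).
- exact: iota_uniq.
- by [].
- by move=> i j _ _; apply: branch_edges_disjoint.
Qed.

Lemma mean_total n v : mean (linked_term n v) + mean (unlinked_term n v) =
  mean (fun w => q ^+ isolated c (edge_state w) n v).
Proof.
rewrite -bernoulli_meanD; apply: eq_bernoulli_mean => w.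
by rewrite /linked_term /unlinked_term -mulrDr; case: (linked _ _ _ _);
  rewrite ?addr0 ?add0r mulr1.
Qed.

Lemma linked_mean_ge0 n v : 0 <= mean (linked_term n v).
Proof.
apply: bernoulli_mean_ge0 => [|w]; first by case/andP: p01 => /ltW-> /ltW->.
by rewrite mulr_ge0 // exprn_ge0 // ltW.
Qed.

Lemma unlinked_mean_ge0 n v : 0 <= mean (unlinked_term n v).
Proof.
apply: bernoulli_mean_ge0 => [|w]; first by case/andP: p01 => /ltW-> /ltW->.
by rewrite mulr_ge0 // exprn_ge0 // ltW.
Qed.

(** The partition function of the subtree of [v], up to the factor [q] of the
    boundary cluster. *)
Lemma mean_weight_gt0 n v : 0 < mean (linked_term n v) + q * mean (unlinked_term n v).
Proof.
have : 0 < mean (linked_term n v) + mean (unlinked_term n v).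
  by rewrite mean_total; apply: bernoulli_mean_gt0 => // w; apply: exprn_gt0.
have := linked_mean_ge0 n v; have := unlinked_mean_ge0 n v.
rewrite le_eqVlt => /predU1P[<-|d0] a0; first by rewrite mulr0.
by move=> _; apply: ltr_wpDl => //; apply: mulr_gt0.
Qed.

Lemma mean_branch n v i : rcons v i \in tree_vertices c N ->
  mean (branch_term n (rcons v i)) =
  p * (mean (linked_term n (rcons v i)) + mean (unlinked_term n (rcons v i))) +
  (1 - p) * (mean (linked_term n (rcons v i)) + q * mean (unlinked_term n (rcons v i))).
Proof.
move=> uN; have dA := @linked_term_below n (rcons v i).
have dD := @unlinked_term_below n (rcons v i).
rewrite mean_edge // ?bernoulli_meanD ?bernoulli_meanZ //.
  exact: (@depends_on_comp2 _ _ _ _ +%R).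
exact: (@depends_on_comp2 _ _ _ _ (fun a d => a + q * d)).
Qed.

Lemma mean_unlinked_branch n v i : rcons v i \in tree_vertices c N ->
  mean (unlinked_branch_term n (rcons v i)) =
  p * mean (unlinked_term n (rcons v i)) +
  (1 - p) * (mean (linked_term n (rcons v i)) + q * mean (unlinked_term n (rcons v i))).
Proof.
move=> uN; have dA := @linked_term_below n (rcons v i).
have dD := @unlinked_term_below n (rcons v i).
rewrite mean_edge // ?bernoulli_meanD ?bernoulli_meanZ //.
exact: (@depends_on_comp2 _ _ _ _ (fun a d => a + q * d)).
Qed.

(** [A], [D] are the linked and unlinked weights below a child and [x] is the
    corresponding connection probability; the left-hand side is the total weight
    of the branch and [Q] its unlinked weight. *)
Lemma odds_ratio_branch (A D x : R) (W := A + q * D) (Q := p * D + (1 - p) * W) :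
  A = x * W -> 0 < W -> 0 < Q ->
  p * (A + D) + (1 - p) * W = Q * odds_ratio q (p / (p + q * (1 - p))) x.
Proof.
case/andP: (p01) => p0 p1 xE W0 Q0.
have den0 : 0 < p + q * (1 - p) by rewrite addr_gt0 // mulr_gt0 // subr_gt0.
have -> : x = A / W by rewrite xE mulfK ?gt_eqF.
rewrite /odds_ratio.
have -> : 1 - p / (p + q * (1 - p)) * (A / W) = q * Q / ((p + q * (1 - p)) * W).
  by rewrite /Q /W; field; rewrite !gt_eqF.
have -> : 1 + (q - 1) * (p / (p + q * (1 - p))) * (A / W) =
    q * (p * (A + D) + (1 - p) * W) / ((p + q * (1 - p)) * W).
  by rewrite /W; field; rewrite !gt_eqF.
move: (p + q * (1 - p)) (p * (A + D) + (1 - p) * W) den0 => den num den0.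
by field; rewrite !gt_eqF.
Qed.

(** Both the total weight at [v] and the weight of the configurations where [v]
    is unlinked are products over the branches below [v]; the ratio of these
    products is the product of the odds ratios of the branches. *)
Lemma mean_linked_recursion n v : (size v + n)%N = N ->
  v \in generation c (size v) ->
  mean (linked_term n v) =
  tree_connection q (p / (p + q * (1 - p))) n (fun u => c (v ++ u)) *
  (mean (linked_term n v) + q * mean (unlinked_term n v)).
Proof.
case/andP: (p01) => p0 p1.
have den0 : 0 < p + q * (1 - p) by rewrite addr_gt0 // mulr_gt0 // subr_gt0.
elim: n v => [|n IH] v sv vg.
  rewrite /= mul1r (_ : mean (unlinked_term 0 v) = 0) ?mulr0 ?addr0 //.
  by rewrite /bernoulli_mean big1 // => w _; rewrite /unlinked_term /= !mulr0.
set s := p / _; set y := \prod_(i <- iota 0 (c v))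
  odds_ratio q s (tree_connection q s n (fun u => c (rcons v i ++ u))).
have -> : tree_connection q s n.+1 (fun u => c (v ++ u)) = (y - 1) / (y - 1 + q).
  have -> // : y = \prod_(i <- iota 0 (c (v ++ [::])))
      odds_ratio q s (tree_connection q s n (fun u => c (v ++ i :: u))).
  rewrite cats0 /y; apply: eq_bigr => i _; congr odds_ratio; congr tree_connection.
  by apply/funext => u; rewrite cat_rcons.
have Dd : mean (unlinked_term n.+1 v) =
    \prod_(i <- iota 0 (c v)) mean (unlinked_branch_term n (rcons v i)).
  rewrite -mean_prod_branches.
    by apply: eq_bernoulli_mean => w; rewrite unlinked_prod.
  move=> i w w' ww; rewrite /unlinked_branch_term (edge_state_branch ww).
  have ww' : {in edges_below (rcons v i), w =1 w'}.
    by move=> e /branch_edges_below; apply: ww.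
  by rewrite (linked_term_below _ ww') (unlinked_term_below _ ww').
have AD : mean (linked_term n.+1 v) + mean (unlinked_term n.+1 v) =
    \prod_(i <- iota 0 (c v)) mean (branch_term n (rcons v i)).
  rewrite mean_total -mean_prod_branches.
    by apply: eq_bernoulli_mean => w; rewrite isolated_prod.
  move=> i w w' ww; rewrite /branch_term (edge_state_branch ww).
  have ww' : {in edges_below (rcons v i), w =1 w'}.
    by move=> e /branch_edges_below; apply: ww.
  by rewrite (linked_term_below _ ww') (unlinked_term_below _ ww').
have child i : i \in iota 0 (c v) -> 0 < mean (unlinked_branch_term n (rcons v i)) /\
    mean (branch_term n (rcons v i)) = mean (unlinked_branch_term n (rcons v i)) *
      odds_ratio q s (tree_connection q s n (fun u => c (rcons v i ++ u))).
  rewrite mem_iota /= => iv; set u := rcons v i.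
  have ug : u \in generation c (size u).
    by rewrite size_rcons mem_generation_rcons vg.
  have su : (size u + n)%N = N by rewrite size_rcons addSnnS.
  have uN : u \in tree_vertices c N by rewrite mem_tree_vertices ug -su leq_addr.
  have W0 := mean_weight_gt0 n u; have D0 := unlinked_mean_ge0 n u.
  have Q0 : 0 < mean (unlinked_branch_term n u).
    rewrite mean_unlinked_branch // ltr_wpDl ?mulr_ge0 //; first exact: ltW.
    by rewrite mulr_gt0 // subr_gt0.
  split=> //; rewrite mean_branch // mean_unlinked_branch // in Q0 *.
  exact: odds_ratio_branch (IH u su ug) W0 Q0.
have Pgt0 : 0 < mean (unlinked_term n.+1 v).
  by rewrite Dd big_seq; apply: prodr_gt0 => i /child[].
have AE : mean (linked_term n.+1 v) = mean (unlinked_term n.+1 v) * (y - 1).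
  rewrite mulrBr mulr1; apply/eqP; rewrite -subr_eq opprK; apply/eqP.
  rewrite AD Dd /y -big_split /=; apply: eq_big_seq => i /child[] //.
have := mean_weight_gt0 n.+1 v; rewrite AE => W.
have yq : y - 1 + q != 0.
  apply: contraTneq W => yq.
  rewrite [X in _ < X](_ : _ = mean (unlinked_term n.+1 v) * (y - 1 + q)).
    by rewrite yq mulr0 ltxx.
  by rewrite [RHS]mulrDr (mulrC q).
rewrite (mulrC q) -mulrDr mulrCA divfK //.
Qed.

Lemma weight_edge_product (w : {ffun E -> bool}) :
  p ^+ num_open w * (1 - p) ^+ num_closed w = \prod_e bernoulli_weight p (w e).
Proof.
rewrite /num_open /num_closed (bigID [pred e | w e]) /=.
rewrite -!prodr_const; congr (_ * _); apply: eq_big => e; rewrite ?inE //=.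
  by move=> we; rewrite /bernoulli_weight we.
by move=> /negbTE we; rewrite /bernoulli_weight we.
Qed.

Lemma rc_connectionE : rc_connection p q (wired_root c N) (wired_boundary c N) =
  tree_connection q (p / (p + q * (1 - p))) N c.
Proof.
have weightE (w : {ffun E -> bool}) : rc_weight p q w =
    q * (\prod_e bernoulli_weight p (w e) *
         (linked_term N [::] w + q * unlinked_term N [::] w)).
  rewrite /rc_weight weight_edge_product num_clusters_wired.
  rewrite /linked_term /unlinked_term.
  move: (linked _ _ _ _) (isolated _ _ _ _) => l k.
  by case: l; rewrite ?add0n ?add1n /= ?exprS; ring.
have total : rc_partition p q (wired_tree c N) =
    q * (mean (linked_term N [::]) + q * mean (unlinked_term N [::])).
  rewrite -bernoulli_meanZ -bernoulli_meanD mulr_sumr.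
  by apply: eq_bigr => w _; apply: weightE.
have W0 := mean_weight_gt0 N [::].
rewrite /rc_connection /rc_prob total.
under eq_bigl do rewrite connect_root_boundary.
transitivity (mean (linked_term N [::]) /
    (mean (linked_term N [::]) + q * mean (unlinked_term N [::]))); last first.
  rewrite [X in X / _](@mean_linked_recursion N [::] (add0n N) isT).
  by rewrite mulfK // gt_eqF.
rewrite -mulr_suml invfM mulrA; congr (_ / _).
rewrite -[RHS](mulfK (lt0r_neq0 q_gt0)); congr (_ / _).
rewrite mulrC mulr_sumr big_mkcond /=; apply: eq_bigr => w _.
rewrite weightE /linked_term /unlinked_term.
move: (\prod_e _) (q ^+ _) (linked _ _ _ _) => a b [] /=; first by ring.
by rewrite !mulr0.
Qed.

End Weights.

Lemma root_connectionE (q beta : R) n c : 0 < q -> 0 < beta ->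
  root_connection c q beta n = tree_connection q (psi q beta) n c.
Proof.
move=> q0 b0; have e1 : expR (- beta) < 1 by rewrite expR_lt1 oppr_lt0.
have e0 := expR_gt0 (- beta).
rewrite /root_connection rc_connectionE //; last by rewrite subr_gt0 e1 ltrBlDr ltrDl.
have b1 : 1 < expR beta by rewrite expR_gt1.
rewrite /psi expRN; move: (expR beta) b1 => b b1; congr tree_connection; field.
by rewrite !gt_eqF //; lra.
Qed.
End ConnectionRecursion.

(** * Linear bounds on the recursion *)

Section Bounds.
Variable R : realType.
Implicit Types (q s r x y z : R) (c : seq nat -> nat).

Lemma saturation_homo q x y : 0 < q -> 0 <= x -> x <= y ->
  x / (x + q) <= y / (y + q).
Proof.
move=> q0 x0 xy; have x_gt0 : 0 < x + q by apply: ltr_wpDl.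
have y_gt0 : 0 < y + q by apply: lt_le_trans x_gt0 _; rewrite lerD2r.
rewrite ler_pdivrMr // mulrAC ler_pdivlMr // !mulrDr (mulrC y x) lerD2l.
by rewrite ler_pM2r.
Qed.

Lemma odds_ratioE q s x : 0 <= s < 1 -> 0 <= x <= 1 ->
  odds_ratio q s x = 1 + q * (s * x) / (1 - s * x).
Proof.
move=> /andP[s0 s1] /andP[x0 x1]; rewrite /odds_ratio; field.
by rewrite gt_eqF //; nra.
Qed.

Lemma odds_ratio_ge q s x : 0 < q -> 0 <= s < 1 -> 0 <= x <= 1 ->
  1 + q * (s * x) <= odds_ratio q s x.
Proof.
move=> q0 s01 x01; rewrite odds_ratioE // lerD2l.
case/andP: s01 x01 => s0 s1 /andP[x0 x1].
rewrite ler_pdivlMr; last by nra.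
have : 0 <= q * (s * x) by rewrite !mulr_ge0 // ltW.
have : 0 <= s * x by rewrite mulr_ge0.
by nra.
Qed.

Section Iterate.
Variables (q s : R) (x : nat -> R).
Hypotheses (q0 : 0 < q) (s01 : 0 <= s < 1) (x01 : forall i, 0 <= x i <= 1).

Lemma prod_odds_ge (t : seq nat) :
  1 + q * (s * \sum_(i <- t) x i) <= \prod_(i <- t) odds_ratio q s (x i).
Proof.
have /andP[s0 _] := s01.
elim: t => [|i t IH]; first by rewrite !big_nil !mulr0 addr0.
rewrite !big_cons; have := odds_ratio_ge q0 s01 (x01 i).
have : 0 <= q * (s * \sum_(j <- t) x j).
  by rewrite !mulr_ge0 ?(ltW q0) ?sumr_ge0 // => j _; case/andP: (x01 j).
have : 0 <= q * (s * x i) by case/andP: (x01 i) => *; rewrite !mulr_ge0 // ltW.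
move: IH; rewrite mulrDr mulrDr.
move: (q * (s * \sum_(j <- t) x j)) (q * (s * x i)) (odds_ratio _ _ _) (\prod_(j <- t) _).
move=> a b o P; nra.
Qed.

Lemma prod_odds_ge1 (t : seq nat) : 1 <= \prod_(i <- t) odds_ratio q s (x i).
Proof.
apply: le_trans (prod_odds_ge t); have /andP[s0 _] := s01.
by rewrite lerDl !mulr_ge0 ?(ltW q0) ?sumr_ge0 // => j _; case/andP: (x01 j).
Qed.

(** The connection probability of two branches together is at most the sum of
    those of each branch alone.  This is where [q <= 2] enters: the gap between
    the two sides is [r z (r + z + r z + q (2 - q))] over a positive
    denominator. *)
Lemma odds_subadditive r z : q <= 2 -> 0 <= r -> 0 <= z ->
  (r + z + r * z) / (r + z + r * z + q) <= r / (r + q) + z / (z + q).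
Proof.
move=> q2 r0 z0.
have rz0 : 0 <= r * z by rewrite mulr_ge0.
have d1 : 0 < r + q by rewrite ltr_wpDl.
have d2 : 0 < z + q by rewrite ltr_wpDl.
have d3 : 0 < r + z + r * z + q by rewrite ltr_wpDl // !addr_ge0.
rewrite -subr_ge0.
have -> : r / (r + q) + z / (z + q) - (r + z + r * z) / (r + z + r * z + q) =
    r * z * (r + z + r * z + q * (2 - q)) / ((r + q) * (z + q) * (r + z + r * z + q)).
  by field; rewrite !gt_eqF.
apply: divr_ge0; last by rewrite !mulr_ge0 // ltW.
apply: mulr_ge0 => //; have : 0 <= q * (2 - q) by rewrite mulr_ge0 ?subr_ge0 // ltW.
lra.
Qed.

Lemma prod_odds_le (t : seq nat) : q <= 2 ->
  (\prod_(i <- t) odds_ratio q s (x i) - 1) /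
  (\prod_(i <- t) odds_ratio q s (x i) - 1 + q) <= s * \sum_(i <- t) x i.
Proof.
move=> q2; have /andP[s0 s1] := s01.
elim: t => [|i t IH]; first by rewrite !big_nil subrr mul0r mulr0.
rewrite !big_cons mulrDr.
set z := \prod_(j <- t) _ - 1 in IH *.
have z0 : 0 <= z by rewrite subr_ge0 prod_odds_ge1.
have /andP[xi0 xi1] := x01 i.
have sx : 0 < 1 - s * x i by nra.
rewrite odds_ratioE //; set r := q * _ / _.
have r0 : 0 <= r by rewrite /r divr_ge0 ?mulr_ge0 // ltW.
have -> : s * x i = r / (r + q).
  rewrite /r; field; rewrite (gt_eqF sx) /=.
  have -> : q * (s * x i) + q * (1 - s * x i) = q by ring.
  by rewrite gt_eqF.
apply: le_trans (lerD (lexx _) IH); have := odds_subadditive q2 r0 z0.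
have -> // : r + z + r * z = (1 + r) * \prod_(j <- t) odds_ratio q s (x j) - 1.
by rewrite /z; ring.
Qed.

End Iterate.

Section TreeConnection.
Variables (q s : R).
Hypotheses (q0 : 0 < q) (s01 : 0 <= s < 1).
Local Notation tc := (tree_connection q s).

Lemma tree_connection01 n c : 0 <= tc n c <= 1.
Proof.
elim: n c => [|n IH] c /=; first by rewrite ler01 lexx.
set y := \prod_(i <- _) _.
have y1 : 1 <= y by apply: prod_odds_ge1.
have y0 : 0 <= y - 1 by rewrite subr_ge0.
have yq : 0 < y - 1 + q by rewrite ltr_wpDl.
by rewrite divr_ge0 ?(ltW yq) // ler_pdivrMr // mul1r lerDl ltW.
Qed.

Lemma tree_connection_le n c : q <= 2 ->
  tc n.+1 c <= s * \sum_(i <- iota 0 (c [::])) tc n (fun u => c (i :: u)).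
Proof.
move=> q2; apply: (prod_odds_le q0 s01 (x := fun i => tc n (fun u => c (i :: u)))) => //.
by move=> i; apply: tree_connection01.
Qed.

(** The product of the odds ratios is at least [1 + q * S], for which the
    right-hand side of the recursion is exactly [S / (1 + S)]. *)
Lemma tree_connection_ge n c
    (S := s * \sum_(i <- iota 0 (c [::])) tc n (fun u => c (i :: u))) :
  S / (1 + S) <= tc n.+1 c.
Proof.
have x01 i : 0 <= tc n (fun u => c (i :: u)) <= 1 by apply: tree_connection01.
have S0 : 0 <= S.
  by rewrite /S mulr_ge0 ?sumr_ge0 //; [case/andP: s01|move=> i _; case/andP: (x01 i)].
have -> : S / (1 + S) = (1 + q * S - 1) / (1 + q * S - 1 + q).
  have -> : 1 + q * S - 1 = q * S by ring.
  have -> : q * S + q = q * (1 + S) by ring.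
  by rewrite -mulf_div divff ?gt_eqF // mul1r.
apply: saturation_homo => //; first by rewrite addrC addKr mulr_ge0 // ltW.
by rewrite lerD2r; apply: (prod_odds_ge q0 s01 x01).
Qed.

End TreeConnection.

Section PrunedFlow.
Variables (s delta : R) (K : nat).
Hypotheses (s01 : 0 <= s < 1) (delta01 : 0 <= delta <= 1).

(** A minorant of the connection probability that is easier to compute with: the
    lower bound [S / (1 + S)] is taken for the recursion itself, only the first
    [K] children of a vertex are kept, and the boundary value is [delta]. *)
Fixpoint pruned_flow n c : R :=
  if n is k.+1 then
    let S := s * \sum_(i < K) (i < c [::])%:R * pruned_flow k (fun u => c (nat_of_ord i :: u)) in
    S / (1 + S)
  else delta.

Definition pruned_inflow n c : R :=
  s * \sum_(i < K) (i < c [::])%:R * pruned_flow n (fun u => c (nat_of_ord i :: u)).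

Lemma pruned_flowS n c :
  pruned_flow n.+1 c = pruned_inflow n c / (1 + pruned_inflow n c).
Proof. by []. Qed.

Lemma pruned_flow01 n c : 0 <= pruned_flow n c <= 1.
Proof.
elim: n c => [|n IH] c; first exact: delta01.
have : 0 <= pruned_inflow n c.
  rewrite mulr_ge0 ?sumr_ge0 //; first by case/andP: s01.
  by move=> i _; rewrite mulr_ge0 // ; case/andP: (IH (fun u => c (nat_of_ord i :: u))).
rewrite pruned_flowS; move: (pruned_inflow n c) => S S0.
have S1 : 0 < 1 + S by rewrite ltr_wpDr.
apply/andP; split; first by apply: divr_ge0 => //; apply: ltW.
by rewrite ler_pdivrMr // mul1r lerDr ler01.
Qed.

Lemma pruned_inflow_ge0 n c : 0 <= pruned_inflow n c.
Proof.
rewrite mulr_ge0 ?sumr_ge0 //; first by case/andP: s01.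
by move=> i _; rewrite mulr_ge0 //; case/andP: (pruned_flow01 n (fun u => c (nat_of_ord i :: u))).
Qed.

Lemma pruned_flow_le n c : pruned_flow n.+1 c <= pruned_inflow n c.
Proof.
have := pruned_inflow_ge0 n c; rewrite pruned_flowS.
by move: (pruned_inflow n c) => S S0; rewrite ler_pdivrMr; nra.
Qed.

Lemma pruned_flow_ge n c :
  pruned_inflow n c - pruned_inflow n c ^+ 2 <= pruned_flow n.+1 c.
Proof.
have := pruned_inflow_ge0 n c; rewrite pruned_flowS.
move: (pruned_inflow n c) => S S0; rewrite ler_pdivlMr; last lra.
rewrite [leLHS](_ : _ = S - S * S * S) ?lerBlDr ?lerDl ?mulr_ge0 //; ring.
Qed.

(** A single branch gives [s y / (1 + s y)], and [s y <= 1]. *)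
Lemma pruned_flow_branch n c i : (i < K)%N -> (i < c [::])%N ->
  s / 2 * pruned_flow n (fun u => c (i :: u)) <= pruned_flow n.+1 c.
Proof.
move=> iK ic; set y := pruned_flow n _.
have /andP[y0 y1] : 0 <= y <= 1 by apply: pruned_flow01.
have /andP[s0 s1] := s01.
have le : s * y <= pruned_inflow n c.
  rewrite /pruned_inflow (bigD1 (Ordinal iK)) //= ic mul1r mulrDr lerDl.
  rewrite mulr_ge0 ?sumr_ge0 // => j _; rewrite mulr_ge0 //.
  by case/andP: (pruned_flow01 n (fun u => c (nat_of_ord j :: u))).
apply: (@le_trans _ _ (s * y / (s * y + 1))); last first.
  by rewrite pruned_flowS (addrC 1); apply: saturation_homo le; rewrite ?mulr_ge0.
have sy0 : 0 <= s * y by rewrite mulr_ge0.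
have sy1 : s * y <= 1 by nra.
by rewrite ler_pdivlMr; nra.
Qed.

Lemma pruned_flow_connection q n c : 0 < q ->
  pruned_flow n c <= tree_connection q s n c.
Proof.
move=> q0; elim: n c => [|n IH] c; first by case/andP: delta01.
apply: le_trans (tree_connection_ge q0 s01 n c).
rewrite pruned_flowS !(addrC 1); apply: saturation_homo => //.
  exact: pruned_inflow_ge0.
have tc0 i : 0 <= tree_connection q s n (fun u => c (i :: u)).
  by case/andP: (tree_connection01 q0 s01 n (fun u => c (i :: u))).
apply: ler_wpM2l; first by case/andP: s01.
apply: (@le_trans _ _ (\sum_(i < K | (i < c [::])%N)
    tree_connection q s n (fun u => c (nat_of_ord i :: u)))).
  rewrite [leRHS]big_mkcond; apply: ler_sum => i _ /=.
  by case: (_ < _)%N; rewrite ?mul1r ?mul0r.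
set f := fun i => tree_connection q s n (fun u => c (i :: u)).
rewrite -(big_mkord (fun i => (i < c [::])%N) f) -{2}(subn0 (c [::])).
rewrite -[X in _ <= X]/(\sum_(0 <= i < c [::]) f i).
rewrite (big_nat_widen 0 K (maxn K (c [::]))) ?leq_maxl //.
rewrite (big_nat_widen 0 (c [::]) (maxn K (c [::]))) ?leq_maxr //=.
rewrite big_mkcond [leRHS]big_mkcond /=; apply: ler_sum => i _.
by do 2 case: (_ < _)%N => //=; apply: tc0.
Qed.

End PrunedFlow.
End Bounds.

(** * Galton-Watson trees and the first moment *)

Section Measurability.
Context d (T : measurableType d) (R : realType).

Lemma measurable_select (N : T -> nat) (f : nat -> T -> R) :
  measurable_fun setT N -> (forall k, measurable_fun setT (f k)) ->
  measurable_fun setT (fun t => f (N t) t).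
Proof.
move=> mN mf _ B mB; rewrite setTI.
rewrite (_ : _ @^-1` B = \bigcup_k (N @^-1` [set k] `&` f k @^-1` B)); last first.
  apply/seteqP; split => [t Bt|t [k _ [/= <-]]] //.
  by exists (N t).
apply: bigcup_measurable => k _; apply: measurableI.
  by rewrite -[X in measurable X]setTI; apply: mN.
by rewrite -[X in measurable X]setTI; apply: mf.
Qed.

(** The inverse of a positive real is one of its real powers, and these are
    measurable functions on the whole line. *)
Lemma measurable_inv_pos (f : T -> R) : (forall t, 0 < f t) ->
  measurable_fun setT f -> measurable_fun setT (fun t => (f t)^-1).
Proof.
move=> f0 mf; rewrite (_ : (fun t => _) = (fun t => f t `^ (-1))).
  exact: (measurableT_comp (measurable_powR _)).
by apply/funext => t; rewrite powR_inv1 // ltW.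
Qed.

Lemma measurable_tree_connection (q s : R) n (xi : seq nat -> T -> nat) :
  0 < q -> 0 <= s < 1 -> (forall u, measurable_fun setT (xi u)) ->
  measurable_fun setT (fun t => tree_connection q s n (fun u => xi u t)).
Proof.
move=> q0 s01; elim: n xi => [|n IH] xi mxi /=; first exact: measurable_cst.
pose x i t := tree_connection q s n (fun u => xi (i :: u) t).
have mx i : measurable_fun setT (x i) by apply: IH.
have x01 i t : 0 <= x i t <= 1 by apply: tree_connection01.
have modds i : measurable_fun setT (fun t => odds_ratio q s (x i t)).
  apply: measurable_funM.
    by apply: measurable_funD => //; apply: measurable_funM.
  apply: measurable_inv_pos => [t|].
    have /andP[s0 s1] := s01; have /andP[y0 y1] := x01 i t.
    by rewrite subr_gt0; apply: le_lt_trans s1; rewrite ler_piMr.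
  by apply: measurable_funB => //; apply: measurable_funM.
pose y k t := \prod_(i <- iota 0 k) odds_ratio q s (x i t).
have my k : measurable_fun setT (y k) by apply: measurable_prod => i _; apply: modds.
apply: (@measurable_select (xi [::]) (fun k t => (y k t - 1) / (y k t - 1 + q))) => // k.
apply: measurable_funM; first exact: measurable_funB.
apply: measurable_inv_pos => [t|]; last by apply: measurable_funD => //; apply: measurable_funB.
by rewrite ltr_wpDl // subr_ge0; apply: prod_odds_ge1.
Qed.

End Measurability.

Section GaltonWatson.
Context (R : realType) (mu : probability nat R).
Context d (T : measurableType d) (P : probability T R).

Definition tail (i : nat) : R := fine (mu [set k | (i < k)%N]).

Lemma tailE i : mu [set k | (i < k)%N] = (tail i)%:E.
Proof. by rewrite /tail fineK // fin_num_measure. Qed.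

Lemma tail_ge0 i : 0 <= tail i.
Proof. by rewrite -lee_fin -tailE. Qed.

(** [k] is the number of [i] with [i < k]; exchange sum and integral. *)
Lemma sum_tail m : ('E_mu[(fun k : nat => k%:R : R)%R] = m%:E)%E ->
  (\sum_(0 <= i <oo) (tail i)%:E)%E = m%:E.
Proof.
rewrite expectation.unlock => <-.
transitivity (\sum_(0 <= i <oo) \int[mu]_k ((i < k)%N%:R : R)%:E)%E.
  apply: eq_eseriesr => i _; rewrite -tailE -[X in mu X]setIT -integral_indic //.
  by apply: eq_integral => k _; rewrite indicE mem_setE.
rewrite -integral_nneseries //.
apply: eq_integral => k _.
rewrite (nneseries_split 0 k) //.
rewrite add0n [X in (_ + X)%E]eseries0 ?adde0; last first.
  by move=> i ki _; rewrite ltnNge ki.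
rewrite (eq_big_nat _ _ (F2 := fun=> 1%E)) => [|i /andP[_ ->]//].
by rewrite sumEFin sumr_const_nat subn0.
Qed.

Variable xi : seq nat -> {RV P >-> nat}.

(** The events to which mutual independence applies directly. *)
Definition rectangle (r : seq (seq nat)) (A : seq nat -> set nat) : set T :=
  [set t | forall u, u \in r -> A u (xi u t)].

Lemma rectangle_cons u r A B : u \notin r ->
  rectangle (u :: r) (fun v => if v == u then B else A v) =
  rectangle r A `&` [set t | B (xi u t)].
Proof.
move=> ur; apply/seteqP; split=> t /=.
  move=> H; split=> [v vr|]; last by have := H u (mem_head _ _); rewrite eqxx.
  by have := H v; rewrite inE vr orbT (negbTE (memPn ur v vr)); apply.
move=> [H Bu] v; rewrite inE; case: eqP => [-> _ //|_ /= vr]; exact: H.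
Qed.

Lemma measurable_rectangle r A : measurable (rectangle r A).
Proof.
elim: r => [|u r IH].
  rewrite (_ : rectangle _ _ = setT) //; by apply/seteqP; split.
rewrite (_ : rectangle _ _ = rectangle r A `&` (xi u @^-1` A u)).
  by apply: measurableI => //; apply: measurable_funPTI.
apply/seteqP; split=> t /=.
  by move=> H; split; [move=> v vr|]; apply: H; rewrite inE ?eqxx ?vr ?orbT.
by move=> [H Au] v; rewrite inE => /predU1P[->|/H].
Qed.

Hypothesis gw : galton_watson mu xi.

Lemma rectangle_prob r A : uniq r ->
  P (rectangle r A) = (\prod_(u <- r) mu (A u))%E.
Proof.
move=> ur; case: gw => dist ind; rewrite [LHS]ind //.
by apply: eq_bigr => u _; rewrite -(dist u).
Qed.

Lemma rectangle_prob_cons u r A B : uniq r -> u \notin r ->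
  P (rectangle r A `&` [set t | B (xi u t)]) = (P (rectangle r A) * mu B)%E.
Proof.
move=> ur uNr; rewrite -rectangle_cons // !rectangle_prob //= ?uNr //.
rewrite big_cons eqxx muleC; congr (_ * _)%E; apply: eq_big_seq => v vr.
by rewrite (negbTE (memPn uNr v vr)).
Qed.

End GaltonWatson.

Section OffspringLaw.
Context (R : realType) (mu : probability nat R) (m : R).
Hypotheses (mu0 : mu [set 0%N] = 0%E) (mu1 : (mu [set 1%N] < 1)%E).
Hypothesis mean_mu : ('E_mu[(fun k : nat => k%:R : R)%R] = m%:E)%E.

Lemma tail0 : tail mu 0 = 1.
Proof.
apply/EFin_inj; rewrite -tailE (_ : [set k | _] = ~` [set 0%N]).
  by rewrite probability_setC // mu0 sube0.
by apply/seteqP; split=> k /=; [move=> k0 e; rewrite e in k0|case: k].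
Qed.

Lemma tail1_gt0 : 0 < tail mu 1.
Proof.
rewrite -lte_fin -tailE.
have -> : [set k | (1 < k)%N] = ~` ([set 0%N] `|` [set 1%N]).
  by apply/seteqP; split=> [[|[|k]]|[|[|k]]] //=; [move=> _ []|case; left|case; right].
have -> : mu (~` ([set 0%N] `|` [set 1%N])) = (1 - mu [set 1%N])%E.
  rewrite probability_setC //; congr (_ - _)%E.
  rewrite measureU //; last by apply/seteqP; split=> // k /= [->].
  by rewrite -[RHS]add0e; congr (_ + _)%E.
by rewrite sube_gt0.
Qed.

Definition truncated_mean (K : nat) : R := \sum_(i < K) tail mu i.

Lemma truncated_mean_cvg : truncated_mean K @[K --> \oo] --> m.
Proof.
have pos i : (0 <= (tail mu i)%:E)%E by rewrite lee_fin tail_ge0.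
have := @is_cvg_nneseries _ (fun i => (tail mu i)%:E) xpredT 0%N (fun i _ _ => pos i).
rewrite (sum_tail mean_mu) => /fine_cvgP[_].
rewrite (_ : fine \o _ = truncated_mean) //.
by apply/funext => K; rewrite /= sumEFin /truncated_mean big_mkord.
Qed.

Lemma truncated_mean_le K : truncated_mean K <= m.
Proof.
rewrite -lee_fin -(sum_tail mean_mu) /truncated_mean -(big_mkord xpredT (tail mu)) -sumEFin.
by apply: nneseries_lim_ge => i _ _; rewrite lee_fin tail_ge0.
Qed.

Lemma truncated_mean_gt1 K : (1 < K)%N -> 1 < truncated_mean K.
Proof.
case: K => [|[|K]] // _; rewrite /truncated_mean !big_ord_recl tail0 /= ltrDl.
by rewrite ltr_pwDl ?tail1_gt0 // sumr_ge0 // => i _; apply: tail_ge0.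
Qed.

Lemma mean_gt1 : 1 < m.
Proof. exact: lt_le_trans (truncated_mean_gt1 (ltnSn 1)) (truncated_mean_le 2). Qed.

End OffspringLaw.

Section UpperBound.
Context (R : realType) (mu : probability nat R) (m : R).
Hypothesis mean_mu : ('E_mu[(fun k : nat => k%:R : R)%R] = m%:E)%E.
Context d (T : measurableType d) (P : probability T R).
Variable xi : seq nat -> {RV P >-> nat}.
Hypothesis gw : galton_watson mu xi.
Variables (q s : R).
Hypotheses (q0 : 0 < q) (q2 : q <= 2) (s01 : 0 <= s < 1).

Local Notation conn n v t := (tree_connection q s n (fun u => xi (v ++ u) t)).

Lemma measurable_conn n v :
  measurable_fun setT (fun t => conn n v t).
Proof. by apply: measurable_tree_connection. Qed.

Lemma mean_ge0 : 0 <= m.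
Proof.
rewrite -lee_fin -(sum_tail mean_mu); apply: nneseries_ge0 => i _ _.
by rewrite lee_fin tail_ge0.
Qed.

(** The integral is restricted to an event about vertices outside the subtree
    of [v] for the sake of the induction: the number of children of [v] becomes
    part of this event for the subtrees of the children. *)
Lemma integral_connection n v r A : uniq r -> (forall u, u \in r -> ~~ prefix v u) ->
  (\int[P]_(t in rectangle xi r A) (conn n v t)%:E <=
   P (rectangle xi r A) * ((m * s) ^+ n)%:E)%E.
Proof.
have /andP[s0 s1] := s01; have m0 := mean_ge0.
elim: n v r A => [|n IH] v r A ur vr.
  rewrite expr0 mule1 -[X in (_ <= X)%E]mul1e -integral_cst //.
  exact: measurable_rectangle.
have mD := measurable_rectangle xi r A; set D := rectangle xi r A in mD *.
have vNr : v \notin r by apply/negP => /vr; rewrite prefix_refl.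
pose f i t := (s * conn n (rcons v i) t)%:E.
pose g i := f i \_ [set t | (i < xi v t)%N].
have f0 i t : (0 <= f i t)%E.
  rewrite lee_fin mulr_ge0 //.
  by case/andP: (tree_connection01 q0 s01 n (fun u => xi (rcons v i ++ u) t)).
have mf i : measurable_fun setT (f i).
  by apply/measurable_EFinP; apply: measurable_funM => //; apply: measurable_conn.
have mset i : measurable [set t | (i < xi v t)%N].
  exact: (measurable_funPTI (xi v) (Y := [set k | (i < k)%N])).
have g0 i t : (0 <= g i t)%E by rewrite /g patchE; case: ifP.
have mg i : measurable_fun D (g i).
  apply: measurable_funTS; apply/(measurable_restrictT _ (mset i)).
  exact: measurable_funTS.
have vi_r i u : u \in v :: r -> ~~ prefix (rcons v i) u.
  rewrite inE => /predU1P[->|/vr].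
    by apply/negP => /size_prefix; rewrite size_rcons ltnn.
  by apply: contra; apply: prefix_trans; rewrite -cats1 prefix_prefix.
apply: (@le_trans _ _ (\int[P]_(t in D) \sum_(0 <= i <oo) g i t)%E).
  apply: ge0_le_integral => //.
  - by move=> t _; rewrite lee_fin;
      case/andP: (tree_connection01 q0 s01 n.+1 (fun u => xi (v ++ u) t)).
  - by apply/measurable_EFinP; apply: measurable_funTS; apply: measurable_conn.
  - by apply: ge0_emeasurable_sum.
  move=> t _; apply: (@le_trans _ _ (\sum_(0 <= i < xi v t) g i t)%E); last first.
    by apply: nneseries_lim_ge.
  rewrite (eq_big_nat _ _ (F2 := fun i => (s * conn n (rcons v i) t)%:E)); last first.
    by move=> i /andP[_ it]; rewrite /g patchE mem_set.
  rewrite sumEFin lee_fin -mulr_sumr.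
  apply: le_trans (tree_connection_le q0 s01 _ _ q2) _.
  rewrite cats0 -[iota 0 _]/(iota 0 (xi v t)) /index_iota subn0 ler_wpM2l //.
  apply: ler_sum => i _; rewrite le_eqVlt; apply/orP; left; apply/eqP.
  by congr tree_connection; apply/funext => u; rewrite cat_rcons.
rewrite integral_nneseries //.
apply: (@le_trans _ _ (\sum_(0 <= i <oo) ((P D * (s * (m * s) ^+ n)%:E) * (tail mu i)%:E))%E).
  apply: lee_nneseries => [i _ _|i _]; first exact: integral_ge0.
  rewrite /g -integral_mkcondr /f; under eq_integral do rewrite EFinM.
  rewrite ge0_integralZl ?lee_fin //; last 3 first.
  - exact: measurableI.
  - by apply/measurable_EFinP; apply: measurable_funTS; apply: measurable_conn.
  - by move=> t _; rewrite lee_fin;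
      case/andP: (tree_connection01 q0 s01 n (fun u => xi (rcons v i ++ u) t)).
  rewrite (_ : (P D * _ * _)%E =
    (s%:E * (P D * (tail mu i)%:E * ((m * s) ^+ n)%:E))%E); last first.
    by rewrite EFinM muleCA -!muleA (muleC (tail mu i)%:E).
  apply: lee_wpmul2l; first by rewrite lee_fin.
  rewrite -tailE -(rectangle_prob_cons gw A (fun k => (i < k)%N) ur vNr).
  rewrite /D -(rectangle_cons xi A (fun k => (i < k)%N) vNr).
  by apply: IH => [|u /vi_r //]; rewrite /= vNr.
have PD : P D = (fine (P D))%:E by rewrite fineK // fin_num_measure.
rewrite PD -(EFinM (fine (P D)) (s * _)).
rewrite nneseriesZl; last by move=> i _; rewrite lee_fin tail_ge0.
rewrite (sum_tail mean_mu) -!EFinM lee_fin exprS le_eqVlt.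
by apply/orP; left; apply/eqP; ring.
Qed.

Lemma expected_connection n :
  (\int[P]_t (tree_connection q s n (fun u => xi u t))%:E <= ((m * s) ^+ n)%:E)%E.
Proof.
have := @integral_connection n [::] [::] (fun=> setT) isT.
rewrite (_ : rectangle _ _ _ = setT); last by apply/seteqP; split.
by rewrite probability_setT mul1e; apply.
Qed.

End UpperBound.

(** * Moments of the flow in the truncated tree *)

Section TruncatedOffspring.
Context (R : realType) (mu : probability nat R).
Context d (T : measurableType d) (P : probability T R).
Variables (xi : seq nat -> {RV P >-> nat}) (K : nat).
Hypothesis gw : galton_watson mu xi.

Local Notation V := ('I_K.+1).
Implicit Types (F G : (seq nat -> V) -> R) (v : seq nat).

(** Truncation makes the coordinates take finitely many values, as
    [product_law] requires, and bounds the number of children by [K]. *)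
Definition truncate (k : nat) : V := inord (minn k K).

Definition truncated (t : T) : seq nat -> V := fun u => truncate (xi u t).

Definition mean F : R := (\int[P]_t F (truncated t))%R.

Definition truncated_law (k : V) : R := fine (mu [set j | truncate j == k]).

Lemma cylinder_measurable r F : depends_on r F ->
  measurable_fun setT (fun t => F (truncated t)).
Proof.
elim: r F => [|u r IH] F dF; first by rewrite (depends_on_nil ord0 dF).
pose f k t := F (update (truncated t) u (truncate k)).
rewrite (_ : (fun t => _) = (fun t => f (xi u t) t)); last first.
  apply/funext => t; rewrite /f; congr F; apply/funext => v.
  by rewrite /update; case: eqP => // ->.
apply: measurable_select => // k.
exact: IH (depends_on_update (truncate k) dF).
Qed.

Lemma cylinder_bounded r F : depends_on r F -> exists M, forall c, `|F c| <= M.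
Proof.
elim: r F => [|u r IH] F dF.
  by exists `|F (fun=> ord0)| => c; rewrite [in leLHS](depends_on_nil ord0 dF).
have /choice[M FM] k := IH _ (depends_on_update k dF).
have M0 k : 0 <= M k by apply: le_trans (FM k (fun=> ord0)).
exists (\sum_k M k) => c.
have -> : c = update c u (c u) by apply/funext => v; rewrite /update; case: eqP => // ->.
by apply: le_trans (FM _ _) _; rewrite (bigD1 (c u)) //= lerDl sumr_ge0.
Qed.

Lemma cylinder_integrable r F : depends_on r F ->
  P.-integrable setT (EFin \o (fun t => F (truncated t))).
Proof.
move=> dF; apply: measurable_bounded_integrable => //.
- by rewrite -ge0_fin_numE // fin_num_measure.
- exact: cylinder_measurable dF.
have [M FM] := cylinder_bounded dF; exists M; split; first exact: num_real.
by move=> x Mx t _; apply: le_trans (FM _) (ltW Mx).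
Qed.

Lemma meanD r F G : depends_on r F -> depends_on r G ->
  mean (fun c => F c + G c) = mean F + mean G.
Proof. by move=> dF dG; apply: RintegralD => //; apply: (@cylinder_integrable r). Qed.

Lemma meanZ r a F : depends_on r F -> mean (fun c => a * F c) = a * mean F.
Proof. by move=> dF; apply: RintegralZl => //; apply: (cylinder_integrable dF). Qed.

Lemma mean_cst a : mean (fun=> a) = a.
Proof.
rewrite /mean Rintegral_cst // -[RHS]mulr1; congr (_ * _).
exact: (congr1 fine (probability_setT P)).
Qed.

Lemma mean_sum r (I : Type) (l : seq I) (F : I -> (seq nat -> V) -> R) :
  (forall i, depends_on r (F i)) ->
  mean (fun c => \sum_(i <- l) F i c) = \sum_(i <- l) mean (F i).
Proof.
move=> dF; elim: l => [|i l IH].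
  by rewrite big_nil -[RHS](mean_cst 0); congr mean; apply/funext => c; rewrite big_nil.
rewrite big_cons -IH -(@meanD r) //; last exact: depends_on_sum.
by congr mean; apply/funext => c; rewrite big_cons.
Qed.

Lemma mean_le r F G : depends_on r F -> depends_on r G ->
  (forall c, F c <= G c) -> mean F <= mean G.
Proof.
by move=> dF dG FG; apply: le_Rintegral => //; apply: (@cylinder_integrable r).
Qed.

Lemma mean_indicator (A : set T) F : measurable A ->
  (forall t, F (truncated t) = \1_A t) -> mean F = fine (P A).
Proof.
move=> mA FA; rewrite /mean /Rintegral.
under eq_integral do rewrite FA.
by rewrite integral_indic // setIT.
Qed.

Lemma truncated_product_law : product_law mean truncated_law.
Proof.
split=> [r F dF|r a F dF|r a ur].
- exact: (@mean_sum r).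
- exact: meanZ dF.
pose A u := [set j | truncate j == a u].
rewrite (@mean_indicator (rectangle xi r A)).
- rewrite (rectangle_prob gw) // /truncated_law.
  transitivity (fine (\prod_(u <- r) (fine (mu (A u)))%:E)%E).
    by congr fine; apply: eq_bigr => u _; rewrite fineK // fin_num_measure.
  by rewrite prodEFin.
- exact: measurable_rectangle.
move=> t; rewrite indicE; elim: r {ur} => [|u r IH].
  by rewrite big_nil mem_set.
rewrite big_cons IH -natrM mulnb; congr (_%:R); congr nat_of_bool.
apply/andP/idP => [[tu /set_mem rt]|/set_mem rt].
  by apply/mem_set => v; rewrite inE => /predU1P[->|/rt].
split; first exact: (rt u (mem_head _ _)).
by apply/mem_set => v vr; apply: rt; rewrite inE vr orbT.
Qed.

Lemma truncateE k : (truncate k : nat) = minn k K.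
Proof. by rewrite inordK // ltnS geq_minr. Qed.

Definition has_child (v : seq nat) (i : nat) (c : seq nat -> V) : R := (i < c v)%:R.

Lemma mean_has_child v i : (i < K)%N -> mean (has_child v i) = tail mu i.
Proof.
move=> iK; rewrite (@mean_indicator (xi v @^-1` [set k | (i < k)%N])).
- by rewrite /tail; case: gw => dist _; rewrite -(dist v).
- exact: measurable_funPTI.
move=> t; rewrite /has_child indicE /truncated truncateE leq_min iK andbT.
by congr (_%:R); congr nat_of_bool; apply/idP/idP => [H|/set_mem //]; apply/mem_set.
Qed.

Section Flow.
Variables (s delta : R).
Hypotheses (s01 : 0 <= s < 1) (delta01 : 0 <= delta <= 1).

Definition flow n v (c : seq nat -> V) : R :=
  pruned_flow s delta K n (fun u => nat_of_ord (c (v ++ u))).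

(** The vertices whose offspring numbers determine the flow at [v]. *)
Fixpoint subtree_words n v : seq (seq nat) :=
  if n is k.+1 then v :: flatten [seq subtree_words k (rcons v i) | i <- iota 0 K]
  else [::].

Lemma subtree_words_prefix n v u : u \in subtree_words n v -> prefix v u.
Proof.
elim: n v => //= n IH v; rewrite inE => /predU1P[->|]; first exact: prefix_refl.
move=> /flatten_mapP[i _ /IH]; apply: prefix_trans; rewrite -cats1; exact: prefix_prefix.
Qed.

Lemma subtree_words_child n v i : (i < K)%N ->
  {subset subtree_words n (rcons v i) <= subtree_words n.+1 v}.
Proof.
move=> iK u uv; rewrite /= inE; apply/orP; right; apply/flatten_mapP.
by exists i => //; rewrite mem_iota.
Qed.

Lemma subtree_words_root n v i :
  ~~ has (mem (subtree_words n (rcons v i))) [:: v].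
Proof.
rewrite /= orbF; apply/negP => /subtree_words_prefix /size_prefix.
by rewrite size_rcons ltnn.
Qed.

Lemma subtree_words_disjoint n v i j : i != j ->
  ~~ has (mem (subtree_words n (rcons v j))) (subtree_words n (rcons v i)).
Proof.
move=> ij; apply/hasPn => u /subtree_words_prefix /prefixP[w ->].
apply/negP => /subtree_words_prefix /prefixP[w'].
rewrite !cat_rcons => /eqP; rewrite eqseq_cat // eqxx /= eqseq_cons.
by rewrite (negbTE ij).
Qed.

Definition inflow n v (c : seq nat -> V) : R :=
  s * \sum_(i < K) has_child v i c * flow n (rcons v i) c.

Lemma inflowE n v c :
  inflow n v c = pruned_inflow s delta K n (fun u => nat_of_ord (c (v ++ u))).
Proof.
rewrite /inflow /pruned_inflow; congr (_ * _); apply: eq_bigr => i _.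
rewrite /has_child cats0; congr (_ * _); congr pruned_flow.
by apply/funext => u; rewrite cat_rcons.
Qed.

Lemma flowS n v c : flow n.+1 v c = inflow n v c / (1 + inflow n v c).
Proof. by rewrite inflowE -pruned_flowS. Qed.

Lemma has_child_dep n v i : depends_on (subtree_words n.+1 v) (has_child v i).
Proof.
apply: (@depends_on_coord _ _ _ _ (fun k : V => (i < k)%:R)).
by rewrite /= mem_head.
Qed.

Lemma flow_dep n v : depends_on (subtree_words n v) (flow n v).
Proof.
elim: n v => [//|n IH] v c c' cc; rewrite !flowS; suff -> : inflow n v c = inflow n v c' by [].
congr (_ * _); apply: eq_bigr => i _; congr (_ * _); first exact: has_child_dep cc.
by apply: IH => u /(subtree_words_child (ltn_ord i)); apply: cc.
Qed.

Lemma flow_child_dep n v i : (i < K)%N ->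
  depends_on (subtree_words n.+1 v) (flow n (rcons v i)).
Proof.
move=> iK; apply: (depends_on_sub _ (@flow_dep n (rcons v i))).
exact: subtree_words_child.
Qed.

Lemma inflow_dep n v : depends_on (subtree_words n.+1 v) (inflow n v).
Proof.
move=> c c' cc; rewrite /inflow; congr (_ * _); apply: eq_bigr => i _.
by congr (_ * _); [apply: has_child_dep cc|apply: flow_child_dep cc].
Qed.

Lemma flow01 n v c : 0 <= flow n v c <= 1.
Proof. exact: pruned_flow01. Qed.

(** The number of children of [v] is independent of the subtree of any child,
    whether [i] is that child or not. *)
Lemma mean_has_child_mul n v i j F : (i < K)%N ->
  depends_on (subtree_words n (rcons v j)) F ->
  mean (fun c => has_child v i c * F c) = tail mu i * mean F.
Proof.
move=> iK dF; rewrite -(mean_has_child v iK).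
apply: (product_law_indep truncated_product_law ord0 (subtree_words_root n v j)) => //.
by apply: (@depends_on_coord _ _ _ _ (fun k : V => (i < k)%:R)); rewrite mem_head.
Qed.

(** The factor by which the first moment grows per generation, while the
    saturation [S / (1 + S)] of the recursion is negligible. *)
Definition rate : R := s * \sum_(i < K) tail mu i.

Lemma rate_ge0 : 0 <= rate.
Proof. by case/andP: s01 => s0 _; rewrite mulr_ge0 // sumr_ge0 // => i _; apply: tail_ge0. Qed.

Lemma mean_inflow n v :
  mean (inflow n v) = s * \sum_(i < K) tail mu i * mean (flow n (rcons v i)).
Proof.
have dep (i : 'I_K) : depends_on (subtree_words n.+1 v)
    (fun c => has_child v i c * flow n (rcons v i) c).
  by apply: depends_on_comp2; [apply: has_child_dep|apply: flow_child_dep].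
rewrite (@meanZ (subtree_words n.+1 v)); last exact: depends_on_sum.
rewrite (@mean_sum (subtree_words n.+1 v)) //; congr (_ * _).
by apply: eq_bigr => i _; rewrite (@mean_has_child_mul n v i i) //; apply: flow_dep.
Qed.

Lemma mean_flow_le n v : mean (flow n v) <= delta * rate ^+ n.
Proof.
elim: n v => [|n IH] v; first by rewrite mean_cst mulr1.
apply: (@le_trans _ _ (mean (inflow n v))).
  apply: (@mean_le (subtree_words n.+1 v)); [exact: flow_dep|exact: inflow_dep|].
  by move=> c; rewrite inflowE; apply: pruned_flow_le.
rewrite mean_inflow exprS /rate -/rate mulrCA -mulrA.
have /andP[s0 _] := s01; rewrite ler_wpM2l // mulr_suml ler_sum // => i _.
by rewrite ler_wpM2l ?tail_ge0.
Qed.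

(** Off the diagonal the indicators of the presence of the children are simply
    bounded by 1, which costs the factor [K ^ 2] below. *)
Lemma inflow_sq_le n v c : inflow n v c ^+ 2 <= s ^+ 2 *
  (\sum_(i < K) has_child v i c * flow n (rcons v i) c ^+ 2 +
   \sum_(i < K) \sum_(j < K)
     (i != j)%:R * (flow n (rcons v i) c * flow n (rcons v j) c)).
Proof.
rewrite exprMn ler_wpM2l ?sqr_ge0 // expr2 mulr_suml -big_split /=.
apply: ler_sum => i _; rewrite mulr_sumr (bigD1 i) //=.
have I01 (j : 'I_K) : 0 <= has_child v j c <= 1.
  by rewrite /has_child; case: (_ < _)%N; rewrite ?ler01 ?lexx.
apply: lerD.
  by rewrite /has_child; case: (_ < _)%N; rewrite ?mul0r // !mul1r expr2.
rewrite [leLHS]big_mkcond /=; apply: ler_sum => j _; rewrite eq_sym.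
case: eqP => _; first by rewrite mul0r.
have /andP[i0 i1] := I01 i; have /andP[j0 j1] := I01 j.
have /andP[y0 _] := flow01 n (rcons v i) c; have /andP[z0 _] := flow01 n (rcons v j) c.
rewrite mul1r mulrACA ler_piMl ?mulr_ge0 //; exact: mulr_ile1.
Qed.

Lemma mean_flow_mul n v (i j : 'I_K) : i != j ->
  mean (fun c => flow n (rcons v i) c * flow n (rcons v j) c) =
  mean (flow n (rcons v i)) * mean (flow n (rcons v j)).
Proof.
move=> ij; apply: (product_law_indep truncated_product_law ord0
  (@subtree_words_disjoint n v i j ij)); exact: flow_dep.
Qed.

(** The diagonal terms of the square of a sum over children contribute the
    factor [s * rate] and the others the square of the first moment; as
    [s < rate], the second moment stays comparable to the latter. *)
Lemma mean_inflow_sq_le C n v :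
  K%:R ^+ 2 * s ^+ 2 <= C * (rate ^+ 2 - s * rate) ->
  (forall u, mean (fun c => flow n u c ^+ 2) <= C * (delta * rate ^+ n) ^+ 2) ->
  mean (fun c => inflow n v c ^+ 2) <= C * (delta * rate ^+ n.+1) ^+ 2.
Proof.
move=> CK IH; have /andP[s0 s1] := s01; have /andP[d0 d1] := delta01.
set a := delta * rate ^+ n in IH *.
have a0 : 0 <= a by rewrite mulr_ge0 // exprn_ge0 // rate_ge0.
pose W := subtree_words n.+1 v.
have dsq u : depends_on (subtree_words n u) (fun c => flow n u c ^+ 2).
  exact: (@depends_on_comp _ _ _ _ (fun x => x ^+ 2) _ (@flow_dep n u)).
have d1i (i : 'I_K) : depends_on W (fun c => has_child v i c * flow n (rcons v i) c ^+ 2).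
  apply: depends_on_comp2; first exact: has_child_dep.
  exact: depends_on_sub (subtree_words_child (ltn_ord i)) (dsq _).
have d2ij (i j : 'I_K) : depends_on W
    (fun c => flow n (rcons v i) c * flow n (rcons v j) c).
  by apply: depends_on_comp2; apply: flow_child_dep.
have d2 (i j : 'I_K) : depends_on W
    (fun c => (i != j)%:R * (flow n (rcons v i) c * flow n (rcons v j) c)).
  exact: (@depends_on_comp _ _ _ _ (fun x => (i != j)%:R * x)).
have d2s (i : 'I_K) : depends_on W (fun c => \sum_(j < K)
    (i != j)%:R * (flow n (rcons v i) c * flow n (rcons v j) c)).
  exact: depends_on_sum.
pose Q c := \sum_(i < K) has_child v i c * flow n (rcons v i) c ^+ 2 +
   \sum_(i < K) \sum_(j < K)
     (i != j)%:R * (flow n (rcons v i) c * flow n (rcons v j) c).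
have dQ : depends_on W Q by apply: depends_on_comp2; apply: depends_on_sum.
apply: (@le_trans _ _ (mean (fun c => s ^+ 2 * Q c))).
  apply: (@mean_le W); last exact: inflow_sq_le.
    exact: (@depends_on_comp _ _ _ _ (fun x => x ^+ 2) _ (@inflow_dep n v)).
  exact: (@depends_on_comp _ _ _ _ (fun x => s ^+ 2 * x)).
rewrite (@meanZ W) // (@meanD W); [|exact: depends_on_sum|exact: depends_on_sum].
rewrite !(@mean_sum W) //.
have le1 : \sum_(i < K) mean (fun c => has_child v i c * flow n (rcons v i) c ^+ 2)
    <= (\sum_(i < K) tail mu i) * (C * a ^+ 2).
  rewrite mulr_suml; apply: ler_sum => i _.
  by rewrite (@mean_has_child_mul n v i i) // ler_wpM2l // tail_ge0.
have le2 : \sum_(i < K) mean (fun c => \sum_(j < K)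
    (i != j)%:R * (flow n (rcons v i) c * flow n (rcons v j) c)) <= K%:R ^+ 2 * a ^+ 2.
  apply: (@le_trans _ _ (\sum_(i < K) \sum_(j < K) a ^+ 2)); last first.
    by rewrite !sumr_const !card_ord -mulrnA -[leLHS]mulr_natl natrM -expr2.
  apply: ler_sum => i _; rewrite (@mean_sum W) //; apply: ler_sum => j _.
  rewrite (@meanZ W) //; case: eqP => [_|/eqP ij]; first by rewrite mul0r sqr_ge0.
  have m0 u : 0 <= mean (flow n u).
    rewrite -(mean_cst 0); apply: (@mean_le (subtree_words n u)) => //; first exact: flow_dep.
    by move=> c; case/andP: (flow01 n u c).
  by rewrite mul1r mean_flow_mul // expr2 ler_pM // mean_flow_le.
apply: (@le_trans _ _ (s ^+ 2 * ((\sum_(i < K) tail mu i) * (C * a ^+ 2) +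
  K%:R ^+ 2 * a ^+ 2))); first by rewrite ler_wpM2l ?sqr_ge0 // lerD.
rewrite [leLHS](_ : _ = (s * rate * C + K%:R ^+ 2 * s ^+ 2) * a ^+ 2); last first.
  rewrite /rate; move: (\sum_(i < K) tail mu i) (a ^+ 2) (K%:R ^+ 2 : R) => x y z.
  by ring.
have -> : C * (delta * rate ^+ n.+1) ^+ 2 = (C * rate ^+ 2) * a ^+ 2.
  by rewrite /a (exprS rate n); ring.
rewrite ler_wpM2r ?sqr_ge0 //; move: CK; rewrite mulrBr => CK.
by rewrite -lerBrDl (le_trans CK) // lerD2l lerN2 mulrC.
Qed.

Lemma mean_flow_sq_le C n v : 1 <= C ->
  K%:R ^+ 2 * s ^+ 2 <= C * (rate ^+ 2 - s * rate) ->
  mean (fun c => flow n v c ^+ 2) <= C * (delta * rate ^+ n) ^+ 2.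
Proof.
move=> C1 CK; have C0 : 0 <= C by apply: le_trans C1.
elim: n v => [|n IH] v; first by
  rewrite -[leLHS]/(mean (fun=> delta ^+ 2)) mean_cst mulr1 ler_peMl // sqr_ge0.
apply: le_trans (mean_inflow_sq_le v CK IH).
apply: (@mean_le (subtree_words n.+1 v)).
- exact: (@depends_on_comp _ _ _ _ (fun x => x ^+ 2) _ (@flow_dep n.+1 v)).
- exact: (@depends_on_comp _ _ _ _ (fun x => x ^+ 2) _ (@inflow_dep n v)).
move=> c; have /andP[y0 _] := flow01 n.+1 v c.
have yle : flow n.+1 v c <= inflow n v c by rewrite inflowE; apply: pruned_flow_le.
by rewrite ler_sqr ?nnegrE // (le_trans y0).
Qed.

(** Saturation costs at most the square of the inflow, of mean of order
    [delta ^+ 2 * rate ^+ (2 * n)]; these losses are summable relative to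
    [delta * rate ^+ n], and [delta] is small enough for their sum not to
    exceed half of it. *)
Lemma mean_flow_ge C n v : 1 <= C ->
  K%:R ^+ 2 * s ^+ 2 <= C * (rate ^+ 2 - s * rate) ->
  rate < 1 -> delta = (1 - rate) / (2 * C) ->
  delta * rate ^+ n * (1 + rate ^+ n) / 2 <= mean (flow n v).
Proof.
move=> C1 CK r1 dE; have C0 : 0 < C by apply: lt_le_trans C1.
have /andP[s0 s1] := s01; have /andP[d0 d1] := delta01; have r0 := rate_ge0.
elim: n v => [|n IH] v.
  by rewrite -[leRHS]/(mean (fun=> delta)) mean_cst expr0 mulr1 mulfK.
pose W := subtree_words n.+1 v.
have dsqI : depends_on W (fun c => inflow n v c ^+ 2).
  exact: (@depends_on_comp _ _ _ _ (fun x => x ^+ 2) _ (@inflow_dep n v)).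
have d2 : depends_on W (fun c => - 1 * inflow n v c ^+ 2).
  exact: (@depends_on_comp _ _ _ _ (fun x => - 1 * x ^+ 2) _ (@inflow_dep n v)).
apply: (@le_trans _ _ (mean (fun c => inflow n v c + - 1 * inflow n v c ^+ 2))); last first.
  apply: (@mean_le W); [|exact: flow_dep|].
    by apply: depends_on_comp2; first exact: inflow_dep.
  by move=> c; rewrite inflowE mulN1r; apply: pruned_flow_ge.
rewrite (@meanD W) //; last exact: inflow_dep.
rewrite (meanZ (-1) dsqI).
have sq := mean_inflow_sq_le v CK (fun u => mean_flow_sq_le n u C1 CK).
have le : rate * (delta * rate ^+ n * (1 + rate ^+ n) / 2) <= mean (inflow n v).
  rewrite mean_inflow {1}/rate -mulrA ler_wpM2l // mulr_suml; apply: ler_sum => i _.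
  by rewrite ler_wpM2l ?tail_ge0.
rewrite mulN1r; apply: le_trans (lerB le sq).
have Cd : C * delta = (1 - rate) / 2 by rewrite dE; field; rewrite gt_eqF.
have -> : C * (delta * rate ^+ n.+1) ^+ 2 = (C * delta) * delta * (rate * rate ^+ n) ^+ 2.
  by rewrite (exprS rate n); ring.
rewrite Cd (exprS rate n) -subr_ge0; set x := rate ^+ n.
have x0 : 0 <= x by rewrite exprn_ge0.
rewrite [X in 0 <= X](_ : _ = delta * rate * x * x * (1 - rate) ^+ 2 / 2); last by field.
apply: divr_ge0 => //; apply: mulr_ge0; last exact: sqr_ge0.
by apply: mulr_ge0 => //; apply: mulr_ge0 => //; apply: mulr_ge0.
Qed.

(** The Paley-Zygmund inequality.  The indicator of [y < a / 4] is bounded by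
    the quadratic function [(1 - y / M) ^ 2 + (2 / M) * (a / 4)], and
    [M = 4 * C * a] balances the bounds on the first two moments. *)
Lemma mean_flow_small C n v : 1 <= C ->
  K%:R ^+ 2 * s ^+ 2 <= C * (rate ^+ 2 - s * rate) ->
  0 < rate < 1 -> 0 < delta -> delta = (1 - rate) / (2 * C) ->
  mean (fun c => (flow n v c < delta * rate ^+ n / 4)%R%:R) <= 1 - 1 / (16 * C).
Proof.
move=> C1 CK /andP[r0 r1] d0 dE; have C0 : 0 < C by apply: lt_le_trans C1.
set a := delta * rate ^+ n; have a0 : 0 < a by rewrite mulr_gt0 // exprn_gt0.
pose W := subtree_words n v.
pose M := 4 * C * a; have M0 : 0 < M by rewrite mulr_gt0 // mulr_gt0.
have dY : depends_on W (flow n v) := @flow_dep n v.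
have dlin : depends_on W (fun c => - (2 / M) * flow n v c).
  exact: (@depends_on_comp _ _ _ _ (fun x => - (2 / M) * x)).
have dsq : depends_on W (fun c => flow n v c ^+ 2).
  exact: (@depends_on_comp _ _ _ _ (fun x => x ^+ 2)).
have dsqM : depends_on W (fun c => M ^- 2 * flow n v c ^+ 2).
  exact: (@depends_on_comp _ _ _ _ (fun x => M ^- 2 * x ^+ 2)).
have dls : depends_on W (fun c => - (2 / M) * flow n v c + M ^- 2 * flow n v c ^+ 2).
  exact: depends_on_comp2.
apply: (@le_trans _ _ (mean (fun c => (1 + 2 / M * (a / 4)) +
    (- (2 / M) * flow n v c + M ^- 2 * flow n v c ^+ 2)))).
  apply: (@mean_le W).
  - exact: (@depends_on_comp _ _ _ _ (fun x => (x < a / 4)%R%:R)).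
  - exact: depends_on_comp2.
  move=> c; have /andP[y0 _] := flow01 n v c; move: (flow n v c) y0 => y y0.
  have e : 1 + 2 / M * (a / 4) + (- (2 / M) * y + M ^- 2 * y ^+ 2) =
      (1 - y / M) ^+ 2 + 2 / M * (a / 4) by field; rewrite gt_eqF.
  have q0 : 0 < 2 / M by rewrite divr_gt0.
  case: ltP => ya; last by rewrite e addr_ge0 ?sqr_ge0 // mulr_ge0 ?ltW // divr_gt0.
  rewrite -addrA lerDl addrA addr_ge0 //; last by rewrite mulr_ge0 ?sqr_ge0 // invr_ge0 sqr_ge0.
  by rewrite mulNr -mulrBr mulr_ge0 ?(ltW q0) // subr_ge0 ltW.
rewrite (@meanD W) // mean_cst (@meanD W) // !(@meanZ W) //.
have le1 := mean_flow_ge n v C1 CK r1 dE; rewrite -/a in le1.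
have le2 := mean_flow_sq_le n v C1 CK; rewrite -/a in le2.
have le3 : a / 2 <= mean (flow n v).
  apply: le_trans le1; rewrite ler_pM2r ?invr_gt0 // ler_peMr //; first exact: ltW.
  by rewrite lerDl exprn_ge0 // ltW.
have l1 : - (2 / M) * mean (flow n v) <= - (2 / M) * (a / 2).
  by rewrite ler_wnM2l // oppr_le0 divr_ge0 // ltW.
have l2 : M ^- 2 * mean (fun c => flow n v c ^+ 2) <= M ^- 2 * (C * a ^+ 2).
  by rewrite ler_wpM2l // invr_ge0 sqr_ge0.
apply: le_trans (lerD (lexx _) (lerD l1 l2)) _.
rewrite le_eqVlt; apply/orP; left; apply/eqP; rewrite /M; field.
by rewrite !gt_eqF.
Qed.

Lemma tail_le1 i : tail mu i <= 1.
Proof. by rewrite -lee_fin -tailE probability_le1. Qed.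

(** A small flow at [v] forces small flows at all its children, and, with
    probability [tail mu 1], there are at least two of them. *)
Lemma mean_flow_small_step n v a sigma : (1 < K)%N -> 0 < s -> tail mu 0 = 1 ->
  0 <= sigma -> (forall u, mean (fun c => (flow n u c < a)%R%:R) <= sigma) ->
  mean (fun c => (flow n.+1 v c < s / 2 * a)%R%:R) <=
  sigma * (1 - tail mu 1 * (1 - sigma)).
Proof.
move=> K1 s0 t0 sg0 sg; have K0 : (0 < K)%N by apply: leq_trans K1.
pose W := subtree_words n.+1 v.
pose L i (c : seq nat -> V) : R := (flow n (rcons v i) c < a)%R%:R.
have dL i : depends_on (subtree_words n (rcons v i)) (L i).
  exact: (@depends_on_comp _ _ _ _ (fun x => (x < a)%R%:R) _ (@flow_dep n (rcons v i))).
have dLW i : (i < K)%N -> depends_on W (L i).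
  by move=> iK; apply: depends_on_sub (subtree_words_child iK) (dL i).
have dI i : depends_on W (has_child v i) by apply: has_child_dep.
have mL i : 0 <= mean (L i) <= sigma.
  rewrite sg andbT -(mean_cst 0).
  by apply: (@mean_le (subtree_words n (rcons v i))) => // c; rewrite ler0n.
pose F1 c := - 1 * has_child v 0 c.
pose F2 c := - 1 * (has_child v 1 c * L 0%N c).
pose F3 c := has_child v 1 c * (L 0%N c * L 1%N c).
have dF1 : depends_on W F1 by apply: (@depends_on_comp _ _ _ _ (fun x => - 1 * x)).
have dIL : depends_on W (fun c => has_child v 1 c * L 0%N c).
  by apply: depends_on_comp2 => //; apply: dLW.
have dLL : depends_on W (fun c => L 0%N c * L 1%N c).
  by apply: depends_on_comp2; apply: dLW.
have dF2 : depends_on W F2 by apply: (@depends_on_comp _ _ _ _ (fun x => - 1 * x)).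
have dF3 : depends_on W F3 by apply: depends_on_comp2.
have dA : depends_on W (fun c => L 0%N c + F2 c) by apply: depends_on_comp2 => //; apply: dLW.
have dB : depends_on W (fun c => L 0%N c + F2 c + F3 c) by apply: depends_on_comp2.
have dC : depends_on W (fun c => 1 + F1 c) by apply: depends_on_comp2.
apply: (@le_trans _ _ (mean (fun c => 1 + F1 c + (L 0%N c + F2 c + F3 c)))).
  apply: (@mean_le W); last 1 first.
  - move=> c; have br i : (i < K)%N -> (i < c v)%N ->
        (flow n.+1 v c < s / 2 * a) -> flow n (rcons v i) c < a.
      move=> iK ic; apply: contraTT; rewrite -!leNgt => ay.
      have := @pruned_flow_branch _ _ _ _ s01 delta01 n
        (fun u => nat_of_ord (c (v ++ u))) i iK.
      rewrite cats0 => /(_ ic); apply: le_trans.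
      rewrite (_ : (fun u => _) = (fun u => nat_of_ord (c (rcons v i ++ u)))); last first.
        by apply/funext => u; rewrite cat_rcons.
      by rewrite ler_wpM2l // divr_ge0 // ltW.
    have := br 0%N K0; have := br 1%N K1.
    rewrite /F1 /F2 /F3 /L /has_child.
    case: (flow n.+1 v c < _); last first.
      move=> _ _; case: (0 < c v)%N; case: (1 < c v)%N; case: (flow n (rcons v 0) c < a);
      case: (flow n (rcons v 1) c < a) => /=; lra.
    case c0 : (0 < c v)%N; case c1 : (1 < c v)%N => b1 b0.
    - by rewrite (b0 isT isT) (b1 isT isT) /=; lra.
    - rewrite (b0 isT isT) /=; lra.
    - by move: c0 c1; case: (nat_of_ord (c v)).
    - by case: (flow n (rcons v 0) c < a) => /=; lra.
  - exact: (@depends_on_comp _ _ _ _ (fun x => (x < s / 2 * a)%R%:R) _ (@flow_dep n.+1 v)).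
  - exact: depends_on_comp2.
rewrite (meanD dC dB) (meanD (@depends_on_cst _ _ _ W 1) dF1) mean_cst.
rewrite (meanZ (-1) (dI 0%N)) mean_has_child // t0.
rewrite (meanD dA dF3) (meanD (dLW 0%N K0) dF2) (meanZ (-1) dIL).
rewrite (mean_has_child_mul K1 (dL 0%N)).
have -> : mean F3 = tail mu 1 * (mean (L 0%N) * mean (L 1%N)).
  have LL := product_law_indep truncated_product_law ord0
    (@subtree_words_disjoint n v 0 1 isT) (dL 0%N) (dL 1%N).
  rewrite -LL -(mean_has_child v K1).
  apply: (product_law_indep truncated_product_law ord0 (s := [:: v])
    (r := subtree_words n (rcons v 0) ++ subtree_words n (rcons v 1))).
  - by have := subtree_words_root n v 0; have := subtree_words_root n v 1;
      rewrite /= !orbF mem_cat => /negbTE-> /negbTE->.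
  - by apply: (@depends_on_coord _ _ _ _ (fun k : V => (1 < k)%:R)); rewrite mem_head.
  - apply: depends_on_comp2.
      by apply: depends_on_sub (dL 0%N) => u; rewrite mem_cat => ->.
    by apply: depends_on_sub (dL 1%N) => u; rewrite mem_cat => ->; rewrite orbT.
have /andP[x0 xs] := mL 0%N; have /andP[y0 ys] := mL 1%N.
have t1 := tail_ge0 mu 1; have t1' := tail_le1 1.
move: (mean (L 0%N)) (mean (L 1%N)) (tail mu 1) x0 xs y0 ys t1 t1' => x y t x0 xs y0 ys t1 t1'.
rewrite [leLHS](_ : _ = x * (1 - t * (1 - y))); last by ring.
have le : 1 - t * (1 - y) <= 1 - t * (1 - sigma).
  by rewrite lerD2l lerN2 ler_wpM2l // lerD2l lerN2.
have y0' : 0 <= 1 - t * (1 - y).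
  rewrite subr_ge0; apply: le_trans (_ : t * 1 <= 1); last by rewrite mulr1.
  by rewrite ler_wpM2l // lerBlDr lerDl.
by apply: ler_pM.
Qed.

End Flow.
End TruncatedOffspring.

(** * The lower bound in probability *)

Section LowerBound.
Context (R : realType) (mu : probability nat R).
Hypotheses (mu0 : mu [set 0%N] = 0%E) (mu1 : (mu [set 1%N] < 1)%E).
Context d (T : measurableType d) (P : probability T R).
Variables (xi : seq nat -> {RV P >-> nat}).
Hypothesis gw : galton_watson mu xi.
Variables (q s : R).
Hypotheses (q0 : 0 < q) (s0 : 0 < s) (s1 : s < 1).

Let s01 : 0 <= s < 1. Proof. by rewrite ltW. Qed.

Lemma pruned_flow_truncate (delta : R) (K n : nat) (c : seq nat -> nat) :
  pruned_flow s delta K n (fun u => minn (c u) K) = pruned_flow s delta K n c.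
Proof.
elim: n c => //= n IH c; have -> // : \sum_(i < K) (i < minn (c [::]) K)%:R *
    pruned_flow s delta K n (fun u => minn (c (nat_of_ord i :: u)) K) =
  \sum_(i < K) (i < c [::])%:R * pruned_flow s delta K n (fun u => c (nat_of_ord i :: u)).
by apply: eq_bigr => i _; rewrite leq_min ltn_ord andbT (IH (fun u => c (nat_of_ord i :: u))).
Qed.

Lemma prob_connection_lt (delta : R) (K n : nat) (x : R) : 0 <= delta <= 1 ->
  (P [set t | (tree_connection q s n (fun u => xi u t) < x)%R] <=
   (mean xi (fun c : seq nat -> 'I_K.+1 => (flow s delta n [::] c < x)%R%:R : R))%:E)%E.
Proof.
move=> d01.
pose B : set T := [set t | (flow s delta n [::] (truncated xi K t) < x)%R].
have mB : measurable B.
  have := cylinder_measurable xi (@flow_dep R K s delta n [::]).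
  by move=> /(_ measurableT `]-oo, x[%classic (measurable_itv _)); rewrite setTI;
     congr measurable; apply/seteqP; split=> t /=; rewrite in_itv.
rewrite (@mean_indicator _ _ _ _ _ _ B) //; last first.
  move=> t; rewrite indicE; congr (_%:R); congr nat_of_bool.
  by apply/idP/idP => [H|/set_mem //]; apply/mem_set.
rewrite fineK ?fin_num_measure //; apply: le_measure; rewrite ?inE //.
  have mX : measurable_fun setT (fun t => tree_connection q s n (fun u => xi u t)).
    exact: measurable_tree_connection.
  have := mX measurableT `]-oo, x[%classic (measurable_itv _); rewrite setTI.
  by congr measurable; apply/seteqP; split=> t /=; rewrite in_itv.
move=> t /=; apply: le_lt_trans; rewrite /flow /=.
under eq_fun do rewrite /truncated truncateE.
by rewrite pruned_flow_truncate; apply: pruned_flow_connection.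
Qed.

Section FixedTruncation.
Variables (K : nat) (C delta : R).
Local Notation rho := (rate mu K s).
Hypotheses (K1 : (1 < K)%N) (C1 : 1 <= C)
  (CK : K%:R ^+ 2 * s ^+ 2 <= C * (rho ^+ 2 - s * rho)) (rho01 : 0 < rho < 1)
  (deltaE : delta = (1 - rho) / (2 * C)).

Lemma delta_bounds : 0 < delta <= 1.
Proof.
have C0 : 0 < C by apply: lt_le_trans C1.
have /andP[r0 r1] := rho01; rewrite deltaE divr_gt0 ?subr_gt0 ?mulr_gt0 //=.
rewrite ler_pdivrMr ?mulr_gt0 // mul1r; move: rho r0 C1 => r r0 c1; lra.
Qed.

(** By [mean_flow_small], [survival] is a lower bound for the probability that
    the flow is not small; [contraction] is the resulting factor in
    [mean_flow_small_step]. *)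
Definition survival : R := 1 / (16 * C).
Definition contraction : R := 1 - tail mu 1 * survival.

Lemma survival_bounds : 0 < survival <= 1.
Proof.
have C0 : 0 < C by apply: lt_le_trans C1.
rewrite divr_gt0 ?mulr_gt0 //= ler_pdivrMr ?mulr_gt0 // mul1r; move: C1 => c1; lra.
Qed.

Lemma contraction_bounds : 0 <= contraction < 1.
Proof.
have /andP[c0 c1] := survival_bounds.
rewrite subr_ge0 ltrBlDr ltrDl mulr_gt0 ?tail1_gt0 // andbT.
by apply: mulr_ile1 => //; rewrite ?tail_ge0 ?tail_le1 // ltW.
Qed.

Lemma mean_flow_small_iter j n v :
  mean xi (fun c : seq nat -> 'I_K.+1 =>
    (flow s delta (j + n) v c < (s / 2) ^+ j * (delta * rho ^+ n / 4))%R%:R : R)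
  <= (1 - survival) * contraction ^+ j.
Proof.
have /andP[d0 d1] := delta_bounds; have /andP[c0 c1] := survival_bounds.
have /andP[k0 k1] := contraction_bounds.
have d01 : 0 <= delta <= 1 by rewrite ltW.
elim: j v => [|j IH] v.
  rewrite add0n !expr0 mul1r mulr1.
  exact: (mean_flow_small gw s01 d01 n v C1 CK rho01 d0 deltaE).
rewrite addSn exprS -mulrA.
have sg0 : 0 <= (1 - survival) * contraction ^+ j.
  by rewrite mulr_ge0 ?subr_ge0 ?exprn_ge0.
apply: le_trans (mean_flow_small_step gw s01 d01 v K1 s0 (tail0 mu0) sg0 IH) _.
rewrite exprSr mulrA ler_wpM2l // /contraction lerD2l lerN2 ler_wpM2l ?tail_ge0 //.
rewrite lerBrDr -lerBrDl; apply: ler_piMr; first by rewrite subr_ge0.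
by apply: exprn_ile1 => //; apply: ltW.
Qed.

(** First choose the number [j] of generations that makes the probability small;
    then, as [l < rho], the geometric sequence [l ^ n] drops below
    [rho ^ (n - j)] times any fixed constant. *)
Lemma prob_connection_small (l e : R) : 0 <= l < rho -> 0 < e ->
  \forall n \near \oo,
   (P [set t | (tree_connection q s n (fun u => xi u t) <= l ^+ n)%R] <= e%:E)%E.
Proof.
move=> /andP[l0 lr] e0; have /andP[r0 r1] := rho01.
have /andP[d0 d1] := delta_bounds; have /andP[c0 c1] := survival_bounds.
have /andP[k0 k1] := contraction_bounds.
have d01 : 0 <= delta <= 1 by rewrite ltW.
have [j ej] : exists j, contraction ^+ j < e.
  have /cvgr0_norm_lt /(_ e e0) [j _ /(_ j (leqnn j))] :
      contraction ^+ n @[n --> \oo] --> (0 : R).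
    by apply: cvg_expr; rewrite ger0_norm.
  by move=> /= ej; exists j; apply: le_lt_trans ej; apply: ler_norm.
pose b := (s / 2) ^+ j * (delta / 4) / rho ^+ j.
have b0 : 0 < b by rewrite divr_gt0 ?mulr_gt0 ?exprn_gt0 ?divr_gt0.
have lr0 : 0 <= l / rho by rewrite divr_ge0 // ltW.
have : (l / rho) ^+ n @[n --> \oo] --> (0 : R).
  by apply: cvg_expr; rewrite ger0_norm // ltr_pdivrMr // mul1r.
move=> /cvgr0_norm_lt /(_ b b0) near_b.
near=> n.
have jn : (j <= n)%N by near: n; exists j.
have lnb : l ^+ n < (s / 2) ^+ j * (delta * rho ^+ (n - j) / 4).
  have : `|(l / rho) ^+ n| < b by near: n.
  rewrite ger0_norm ?exprn_ge0 // expr_div_n ltr_pdivrMr ?exprn_gt0 //.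
  move/lt_le_trans; apply; rewrite le_eqVlt; apply/orP; left; apply/eqP.
  have -> : rho ^+ n = rho ^+ j * rho ^+ (n - j) by rewrite -exprD subnKC.
  rewrite /b; field.
  by rewrite gt_eqF // exprn_gt0.
have := mean_flow_small_iter j (n - j) [::]; rewrite subnKC // => le.
apply: (@le_trans _ _ (P [set t | (tree_connection q s n (fun u => xi u t) <
    (s / 2) ^+ j * (delta * rho ^+ (n - j) / 4))%R])).
  have mX : measurable_fun setT (fun t => tree_connection q s n (fun u => xi u t)).
    exact: measurable_tree_connection.
  apply: le_measure; rewrite ?inE.
  - have := mX measurableT `]-oo, l ^+ n]%classic (measurable_itv _); rewrite setTI.
    by congr measurable; apply/seteqP; split=> t /=; rewrite in_itv.
  - have := mX measurableT `]-oo, (s / 2) ^+ j * (delta * rho ^+ (n - j) / 4)[%classic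
      (measurable_itv _); rewrite setTI.
    by congr measurable; apply/seteqP; split=> t /=; rewrite in_itv.
  by move=> t /= /le_lt_trans; apply.
apply: le_trans (prob_connection_lt K n _ d01) _.
rewrite lee_fin; apply: le_trans le _; apply: le_trans (ltW ej).
by rewrite ler_piMl ?exprn_ge0 // gerBl ltW.
Unshelve. all: by end_near.
Qed.

End FixedTruncation.
End LowerBound.

(** * Convergence *)

Section Psi.
Variable R : realType.
Implicit Types q x y : R.

Lemma psi_bounds q x : 0 < q -> 0 < x -> 0 < psi q x < 1.
Proof.
move=> q0 x0; have e1 : 1 < expR x by rewrite expR_gt1.
have e2 : 0 < expR x - 1 by rewrite subr_gt0.
have den : 0 < expR x + q - 1 by rewrite addrAC addr_gt0.
by rewrite /psi divr_gt0 //= ltr_pdivrMr // mul1r addrAC ltrDl.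
Qed.

Lemma psi_lt q x y : 0 < q -> 0 < x -> x < y -> psi q x < psi q y.
Proof.
move=> q0 x0 xy; have e1 : 1 < expR x by rewrite expR_gt1.
have e2 : expR x < expR y by rewrite ltr_expR.
rewrite /psi; move: (expR x) (expR y) e1 e2 => a b a1 ab.
have da : 0 < a + q - 1 by lra.
have db : 0 < b + q - 1 by lra.
rewrite -subr_gt0 (_ : _ - _ = q * (b - a) / ((a + q - 1) * (b + q - 1))).
  by rewrite divr_gt0 ?mulr_gt0 // subr_gt0.
by field; rewrite !gt_eqF.
Qed.

End Psi.

Lemma nth_root_exp (R : realType) (x : R) n : (0 < n)%N -> 0 <= x -> (x `^ (n%:R^-1)) ^+ n = x.
Proof.
move=> n0 x0; have n1 : n%:R != 0 :> R by rewrite pnatr_eq0 -lt0n.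
by rewrite -powR_mulrn ?powR_ge0 // -powRrM mulVf // powRr1.
Qed.

Lemma nth_root_le (R : realType) (x a : R) n : (0 < n)%N -> 0 <= x -> 0 < a ->
  (x `^ (n%:R^-1) <= a) = (x <= a ^+ n).
Proof.
move=> n0 x0 a0; rewrite -[in RHS](nth_root_exp n0 x0).
by rewrite ler_pXn2r ?nnegrE ?powR_ge0 // ltW.
Qed.

Lemma nth_root_ge (R : realType) (x a : R) n : (0 < n)%N -> 0 <= x -> 0 < a ->
  (a <= x `^ (n%:R^-1)) = (a ^+ n <= x).
Proof.
move=> n0 x0 a0; rewrite -[in RHS](nth_root_exp n0 x0).
by rewrite ler_pXn2r ?nnegrE ?powR_ge0 // ltW.
Qed.

Section Convergence.
Context (R : realType) (mu : probability nat R) (m : R).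
Hypotheses (mu0 : mu [set 0%N] = 0%E) (mu1 : (mu [set 1%N] < 1)%E).
Hypothesis mean_mu : ('E_mu[(fun k : nat => k%:R : R)%R] = m%:E)%E.
Context d (T : measurableType d) (P : probability T R).
Variable xi : seq nat -> {RV P >-> nat}.
Hypothesis gw : galton_watson mu xi.
Variables (q s : R).
Hypotheses (q0 : 0 < q) (q2 : q <= 2) (s01 : 0 < s < 1) (subcritical : m * s < 1).

Local Notation conn n t := (tree_connection q s n (fun u => xi u t)).

Lemma conn01 n t : 0 <= conn n t <= 1.
Proof. by have /andP[s0 s1] := s01; apply: tree_connection01 => //; rewrite ltW. Qed.

Lemma measurable_root_conn n : measurable_fun setT (fun t => conn n t).
Proof. by have /andP[s0 s1] := s01; apply: measurable_tree_connection => //; rewrite ltW. Qed.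

Lemma growth_gt0 : 0 < m * s.
Proof.
have /andP[s0 _] := s01; rewrite mulr_gt0 //.
exact: lt_trans ltr01 (mean_gt1 mu0 mu1 mean_mu).
Qed.

(** Choose [K] so large that the growth rate of the truncated tree exceeds
    [l]. *)
Lemma prob_connection_low l e : 0 < l < m * s -> 0 < e ->
  \forall n \near \oo, (P [set t | (conn n t <= l ^+ n)%R] <= e%:E)%E.
Proof.
move=> /andP[l0 lm] e0; have /andP[s0 s1] := s01.
have [K K1 lK] : exists2 K, (1 < K)%N & l < rate mu K s.
  have : \forall K \near \oo, l / s < truncated_mean mu K.
    apply: (cvgr_gt m (truncated_mean_cvg mean_mu)).
    by rewrite ltr_pdivrMr.
  move=> [K0 _ H]; exists (maxn K0 2); first by rewrite leq_max orbT.
  by rewrite /rate mulrC -ltr_pdivrMr //; apply: H; rewrite /= leq_maxl.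
have M1 := truncated_mean_gt1 mu0 mu1 K1.
have r1 : rate mu K s < 1.
  apply: le_lt_trans subcritical; rewrite /rate mulrC ler_pM2r //.
  exact: truncated_mean_le.
have sr : s < rate mu K s by rewrite /rate ltr_pMr.
have r0 : 0 < rate mu K s by apply: lt_trans sr.
have gap : 0 < rate mu K s ^+ 2 - s * rate mu K s by rewrite expr2 -mulrBl mulr_gt0 // subr_gt0.
pose C := 1 + K%:R ^+ 2 * s ^+ 2 / (rate mu K s ^+ 2 - s * rate mu K s).
have C1 : 1 <= C by rewrite lerDl divr_ge0 ?mulr_ge0 ?sqr_ge0 // ltW.
apply: (@prob_connection_small _ _ mu0 mu1 _ _ _ _ gw _ _ q0 s0 s1 K C _ K1 C1) => //.
- by rewrite /C mulrDl mul1r divfK ?gt_eqF // lerDr ltW.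
- by rewrite r0.
- by rewrite lK ltW.
Qed.

Lemma prob_connection_high u e : m * s < u -> 0 < e ->
  \forall n \near \oo, (P [set t | (u ^+ n <= conn n t)%R] <= e%:E)%E.
Proof.
move=> lu e0; have /andP[s0 s1] := s01; have l0 := growth_gt0.
have u0 : 0 < u by apply: lt_trans lu.
have bound n : (P [set t | (u ^+ n <= conn n t)%R] <= ((m * s / u) ^+ n)%:E)%E.
  have un0 : 0 < u ^+ n by rewrite exprn_gt0.
  have mE : measurable [set t | (u ^+ n <= conn n t)%R].
    have := measurable_root_conn n measurableT (measurable_itv `[u ^+ n, +oo[); rewrite setTI.
    by congr measurable; apply/seteqP; split=> t /=; rewrite in_itv /= andbT.
  have : ((u ^+ n)%:E * P [set t | (u ^+ n <= conn n t)%R] <= ((m * s) ^+ n)%:E)%E.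
    have s01' : 0 <= s < 1 by rewrite ltW.
    apply: le_trans (expected_connection mean_mu gw q0 q2 s01' n).
    rewrite -[X in P X]setIT -(integral_indic _ measurableT mE) -ge0_integralZl //.
    - apply: ge0_le_integral => //.
      + by move=> t _; rewrite -EFinM lee_fin mulr_ge0 // ltW.
      + by apply: measurable_funeM; apply/measurable_EFinP; apply: measurable_indic.
      + by apply/measurable_EFinP; apply: measurable_root_conn.
      move=> t _; rewrite -EFinM lee_fin indicE.
      case: (boolP (t \in _)) => [/set_mem|_]; first by rewrite mulr1.
      by rewrite mulr0; case/andP: (conn01 n t).
    - by apply/measurable_EFinP; apply: measurable_indic.
    - by rewrite lee_fin ltW.
  have -> : P [set t | (u ^+ n <= conn n t)%R] =
      (fine (P [set t | (u ^+ n <= conn n t)%R]))%:E by rewrite fineK // fin_num_measure.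
  rewrite -EFinM !lee_fin expr_div_n => le.
  by rewrite ler_pdivlMr // mulrC.
have : (m * s / u) ^+ n @[n --> \oo] --> (0 : R).
  by apply: cvg_expr; rewrite ger0_norm ?divr_ge0 ?ltW // ltr_pdivrMr // mul1r.
move=> /cvgr0Pnorm_le /(_ e e0) H; near=> n.
apply: le_trans (bound n) _; rewrite lee_fin; apply: le_trans (ler_norm _) _.
by near: n.
Unshelve. all: by end_near.
Qed.

(** Lower deviations are those below [l = max (lam - eps) (lam / 2)], where the
    second term keeps [l] positive. *)
Lemma connection_root_cvg :
  cvg_in_probability P (fun n t => conn n t `^ (n%:R^-1)) (m * s).
Proof.
have mX n : measurable_fun setT (fun t => conn n t `^ (n%:R^-1)).
  exact: (measurableT_comp (measurable_powR _) (measurable_root_conn n)).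
split=> // eps eps0; have l0 := growth_gt0; set lam := m * s in l0 *.
pose l := Num.max (lam - eps) (lam / 2).
have l_gt0 : 0 < l by rewrite lt_max divr_gt0 ?orbT.
have l_lt : l < lam by rewrite gt_max ltrBlDr ltrDl eps0 /= gtr_pMr // invf_lt1 // ltr1n.
have u_gt : lam < lam + eps by rewrite ltrDl.
have u_gt0 : 0 < lam + eps by rewrite addr_gt0.
have mdev n : measurable [set t | eps <= `|conn n t `^ (n%:R^-1) - lam|].
  have := measurableT_comp (@normr_measurable R setT) (measurable_funB (mX n) (measurable_cst lam)).
  move=> /(_ measurableT _ (measurable_itv `[eps, +oo[)); rewrite setTI.
  by congr measurable; apply/seteqP; split=> t /=; rewrite in_itv /= andbT.
apply: cvg_EFin; first by apply: nearW => n; rewrite fin_num_measure.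
apply/cvgr0Pnorm_le => e e0; have e20 : 0 < e / 2 by rewrite divr_gt0.
have llow : 0 < l < m * s by rewrite l_gt0.
have low := prob_connection_low llow e20.
have high := prob_connection_high u_gt e20.
near=> n.
have n0 : (0 < n)%N by near: n; exists 1%N.
rewrite /= ger0_norm ?fine_ge0 // -lee_fin fineK ?fin_num_measure //.
have mlow : measurable [set t | conn n t <= l ^+ n].
  have := measurable_root_conn n measurableT (measurable_itv `]-oo, l ^+ n]); rewrite setTI.
  by congr measurable; apply/seteqP; split=> t /=; rewrite in_itv.
have mhigh : measurable [set t | (lam + eps) ^+ n <= conn n t].
  have := measurable_root_conn n measurableT (measurable_itv `[(lam + eps) ^+ n, +oo[).
  rewrite setTI.
  by congr measurable; apply/seteqP; split=> t /=; rewrite in_itv /= andbT.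
apply: (@le_trans _ _ (P ([set t | conn n t <= l ^+ n] `|`
                          [set t | (lam + eps) ^+ n <= conn n t]))).
  apply: le_measure; rewrite ?inE //; first exact: measurableU.
  move=> t /= dev; have /andP[x0 _] := conn01 n t.
  rewrite -nth_root_le // -nth_root_ge //; move: dev; rewrite ler_normr opprB.
  case/orP=> dev; [right|left]; first by rewrite addrC -lerBrDr.
  by rewrite le_max lerBrDl -lerBrDr dev.
apply: le_trans (measureU2 _ mlow mhigh) _.
rewrite (splitr e) EFinD; apply: leeD; near: n; [exact: low|exact: high].
Unshelve. all: by end_near.
Qed.

End Convergence.

Theorem theorem2p7 (R : realType)
  (mu : probability nat R)
  (mu0 : mu [set 0%N] = 0%E) (mu1 : (mu [set 1%N] < 1)%E)
  (m : R) (mean_mu : ('E_mu[(fun k : nat => k%:R : R)%R] = m%:E)%E)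
  (d : measure_display) (Omega : measurableType d) (P : probability Omega R)
  (xi : seq nat -> {RV P >-> nat}) (gw : galton_watson mu xi)
  (q : R) (q_gt0 : 0 < q) (q_le2 : q <= 2)
  (beta_c : R) (beta_cE : m * psi q beta_c = 1)
  (beta : R) (beta_gt0 : 0 < beta) (beta_lt : beta < beta_c) :
  cvg_in_probability P
    (fun n t =>
       root_connection (fun u => xi u t) q beta n `^ (n%:R^-1))
    (m * psi q beta)
  /\ m * psi q beta < 1.
Proof.
have subcritical : m * psi q beta < 1.
  rewrite -beta_cE ltr_pM2l ?psi_lt //.
  exact: lt_trans ltr01 (mean_gt1 mu0 mu1 mean_mu).
split=> //; have s01 := psi_bounds q_gt0 beta_gt0.
rewrite (_ : (fun n t => _) = (fun n t =>
    tree_connection q (psi q beta) n (fun u => xi u t) `^ (n%:R^-1))).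
  exact: (connection_root_cvg mu0 mu1 mean_mu gw q_gt0 q_le2 s01 subcritical).
by apply/funext => n; apply/funext => t; rewrite root_connectionE.
Qed.
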